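(* Let $S\subset[m]\times[n]$ be a zero pattern which is permutationally equivalent to the diagonal zero pattern $\{(1,1),\ldots,(|S|,|S|)\}$. Then $$\mathrm{EDdegree}(\mathcal{L}_1^S)=\sum_{j=0}^{|S|}\binom{|S|}{j}\min\{m-j,\,n-|S|+j\}.$$
   Context: Notation: $[m]=\{1,\dots,m\}$. A zero pattern is a subset $S\subset[m]\times[n]$. Its mask matrix $M^S$ is the $m\times n$ matrix with entries in $\{0,1\}$ whose $(i,j)$-th entry is $\chi_S(i,j)$, the characteristic function of $S$. Two zero patterns $S_1,S_2$ are permutationally equivalent if there exist permutation matrices $P_1,P_2$ with $M^{S_1}=P_1M^{S_2}P_2$. $\mathcal{L}^S=\{X=(x_{ij})\in\mathbb{C}^{m\times n}\mid x_{ij}=0\ \forall (i,j)\in S\}$, $\mathcal{X}_1$ is the variety of complex $m\times n$ matrices of rank at most one, and $\mathcal{L}_1^S=\mathcal{X}_1\cap\mathcal{L}^S$. ED degree: for $U=(u_{ij})\in\mathbb{C}^{m\times n}$ let $d_U(X)=\sum_{i,j}(x_{ij}-u_{ij})^2$. A critical point of $d_U$ on an algebraic variety $\mathcal{X}\subset\mathbb{C}^{m\times n}$ is a smooth point $X\in\mathcal{X}$ such that $U-X$ is orthogonal to the tangent space $T_X\mathcal{X}$ with respect to the complex bilinear form $\langle A,B\rangle_F=\mathrm{trace}(AB^T)$. $\mathrm{EDdegree}(\mathcal{X})$ is the number of critical points of $d_U$ on $\mathcal{X}$ for generic $U\in\mathbb{C}^{m\times n}$ (i.e. $U$ outside some proper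 Zariski closed set).
   Formalization: S is taken to be a proper subset of [m]×[n]; for m,n ≥ 1 this excludes only m = n = 1, S = {(1,1)}, where L_1^S = {0} has ED degree 1 while the formula gives 0. *)

(* Defs.v *)
From mathcomp Require Import all_boot all_order all_algebra.
From mathcomp Require Import boolp classical_sets functions cardinality reals.
From mathcomp Require Import complex.
From mathcomp Require mpoly.

Set Implicit Arguments.
Unset Strict Implicit.
Unset Printing Implicit Defensive.

Import GRing.Theory.
Local Open Scope card_scope.
Local Open Scope classical_set_scope.
Local Open Scope ring_scope.

(* The coordinate ring of the affine space of m x n matrices: the variable of
   index [mxvec_index i j] is the (i, j)-th coordinate function. *)
Definition mxpolyring (C : fieldType) (m n : nat) := mpoly.mpoly (m * n) C.

Definition mxeval (C : fieldType) (m n : nat)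
    (p : mxpolyring C m n) (X : 'M[C]_(m, n)) : C :=
  mpoly.meval (fun k => mxvec X 0 k) p.

Definition mxdiff (C : fieldType) (m n : nat)
    (p : mxpolyring C m n) (X V : 'M[C]_(m, n)) : C :=
  \sum_(i < m) \sum_(j < n)
     mxeval (mpoly.mderiv (mxvec_index i j) p) X * V i j.

Definition zariski_closed (C : fieldType) (m n : nat)
    (Z : set 'M[C]_(m, n)) : Prop :=
  exists I : set (mxpolyring C m n),
    Z = [set X | forall p, I p -> mxeval p X = 0].

Definition zariski_irreducible (C : fieldType) (m n : nat)
    (Z : set 'M[C]_(m, n)) : Prop :=
  Z !=set0 /\
  forall A B : set 'M[C]_(m, n), zariski_closed A -> zariski_closed B ->
    Z `<=` A `|` B -> Z `<=` A \/ Z `<=` B.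

Definition vanishing_ideal (C : fieldType) (m n : nat)
    (A : set 'M[C]_(m, n)) : set (mxpolyring C m n) :=
  [set p | forall X, A X -> mxeval p X = 0].

Definition tangent_space (C : fieldType) (m n : nat)
    (A : set 'M[C]_(m, n)) (X : 'M[C]_(m, n)) : set 'M[C]_(m, n) :=
  [set V | forall p, vanishing_ideal A p -> mxdiff p X V = 0].

Definition has_dim (C : fieldType) (m n : nat)
    (T : set 'M[C]_(m, n)) (d : nat) : Prop :=
  exists B : 'M[C]_(d, m * n),
    row_free B /\ T = [set V | (mxvec V <= B)%MS].

Definition irreducible_chain (C : fieldType) (m n : nat)
    (A : set 'M[C]_(m, n)) (X : 'M[C]_(m, n)) (d : nat) : Prop :=
  exists Z : nat -> set 'M[C]_(m, n),
    (forall i, (i <= d)%N ->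
       [/\ zariski_closed (Z i), zariski_irreducible (Z i),
           Z i `<=` A & Z i X]) /\
    (forall i, (i < d)%N -> Z i `<` Z i.+1).

(* The local dimension of A at X is d.  Chains of irreducible closed subsets of
   A through X correspond to chains of primes of the local ring of A at X, so d
   is the Krull dimension of that ring. *)
Definition has_local_dim (C : fieldType) (m n : nat)
    (A : set 'M[C]_(m, n)) (X : 'M[C]_(m, n)) (d : nat) : Prop :=
  irreducible_chain A X d /\
  forall e, irreducible_chain A X e -> (e <= d)%N.

(* A may be reducible, with components of different dimensions: smoothness at X
   compares the tangent space with the local dimension at X. *)
Definition smooth_point (C : fieldType) (m n : nat)
    (A : set 'M[C]_(m, n)) (X : 'M[C]_(m, n)) : Prop :=
  A X /\ exists d, has_dim (tangent_space A X) d /\ has_local_dim A X d.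

Definition critical_points (C : fieldType) (m n : nat)
    (A : set 'M[C]_(m, n)) (U : 'M[C]_(m, n)) : set 'M[C]_(m, n) :=
  [set X | smooth_point A X /\
           forall V, tangent_space A X V -> \tr ((U - X) *m V^T) = 0].

(* EDdegree(A) = d, as a relation; over an infinite field it determines d. *)
Definition is_EDdegree (C : fieldType) (m n : nat)
    (A : set 'M[C]_(m, n)) (d : nat) : Prop :=
  exists W : set 'M[C]_(m, n),
    [/\ zariski_closed W, W <> setT &
        forall U, ~ W U -> critical_points A U #= `I_d].

Definition mask (m n : nat) (S : {set 'I_m * 'I_n}) : 'M[int]_(m, n) :=
  \matrix_(i, j) ((i, j) \in S)%:R.

Definition perm_equivalent (m n : nat) (S1 S2 : {set 'I_m * 'I_n}) : Prop :=
  exists (P1 : 'M[int]_m) (P2 : 'M[int]_n),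
    [/\ is_perm_mx P1, is_perm_mx P2 & mask S1 = P1 *m mask S2 *m P2].

(* The pattern {(1,1), ..., (s,s)}, with indices starting from 0. *)
Definition diag_pattern (m n s : nat) : {set 'I_m * 'I_n} :=
  [set ij : 'I_m * 'I_n | (ij.1 == ij.2 :> nat) && (ij.1 < s)%N]%SET.

Definition pattern_space (C : fieldType) (m n : nat)
    (S : {set 'I_m * 'I_n}) : set 'M[C]_(m, n) :=
  [set X | forall i j, (i, j) \in S -> X i j = 0].
Arguments pattern_space C {m n} S _ : assert.

Definition rank_le1 (C : fieldType) (m n : nat) : set 'M[C]_(m, n) :=
  [set X | (\rank X <= 1)%N].
Arguments rank_le1 : clear implicits.

Definition rank_le1_pattern (C : fieldType) (m n : nat)
    (S : {set 'I_m * 'I_n}) : set 'M[C]_(m, n) :=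
  rank_le1 C m n `&` pattern_space C S.
Arguments rank_le1_pattern C {m n} S _ : assert.

(* Main.v *)
Require Import Defs.
From HB Require Import structures.
From mathcomp Require Import all_boot all_order all_algebra.
From mathcomp Require Import boolp classical_sets functions cardinality reals.
From mathcomp Require Import complex.
From mathcomp Require Import -(notations) mpoly.
From mathcomp Require Import ring fingroup perm.

(** The zero pattern enters only through the fact that no two positions of [S]
    share a row or a column.  A matrix [a *m b^T] of rank one vanishes on [S]
    exactly when, for each (i, j) in [S], [a i = 0] or [b j = 0].  Hence the
    variety is the union, over the subsets [J] of [S], of the sets of matrices
    of rank at most one that vanish on the rows of [J] and on the columns of
    [S :\: J]; each is a Segre cone of format (m - |J|) x (n - |S| + |J|).  A
    Segre cone of format p x q has min(p, q) nonzero critical points, so that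
    the sum over [J] is the claimed number, provided that, for general [U], every
    critical point of the union is a smooth point lying on a single component,
    and conversely every critical point of a component is critical for the
    union.

    Critical points of one cone.  Being critical for a p x q matrix [M] says
    that [M^T a = (a.a) b] and [M b = (b.b) a] ([critical_rank1]).  Then [a] is
    an eigenvector of [N = M *m M^T], and [a] determines the critical point
    [a a^T M / (a.a)].  Over the complex numbers [N] may fail to be
    diagonalizable and [a.a] may vanish.  Three polynomial conditions on [M]
    rule this out ([cyclic_gram]): the coordinate vectors and the columns of
    [M] are cyclic vectors of [N], and the discriminant of [N] is nonzero, in
    the form of the determinant of the matrix of the traces of powers of [N].
    For p <= q they give exactly p critical points
    ([wide_expected_critical]); the case p > q follows by transposition.
    Cyclicity also makes every entry of a critical point nonzero.  This is what
    keeps the critical points away from the intersections of the components,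
    which consist of matrices with additional zeros.

    Smoothness.  At a point whose entries in the block of its component are all
    nonzero the variety is parametrized by p + q - 1 coordinates ([chart]).
    The tangent space is computed from lines in the variety, which give tangent
    vectors, and from the equations of the variety, which bound them
    ([tangent_spaceE]).  The local dimension is defined by chains of
    irreducible closed sets.  Lower bound: closures of images of coordinate
    subspaces of the chart ([irreducible_chain_of_chart]).  Upper bound: D + 1
    polynomials in D variables are algebraically dependent, by counting
    monomials, and a dependence relation cannot survive along a chain that is
    too long ([irreducible_chain_le]).

    Conversely, a critical point [X] of the union lies on some component, and
    it is critical there, because the lines of this component through [X] are
    tangent vectors ([critical_point_block]); hence its entries in the block of
    this component are nonzero.  The point 0 is not critical since every
    coordinate direction outside [S] is tangent there. *)

Set Implicit Arguments.
Unset Strict Implicit.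
Unset Printing Implicit Defensive.
Import Order.TTheory GRing.Theory Num.Theory.
Local Open Scope ring_scope.
Local Open Scope classical_set_scope.

(** * Polynomial functions on matrix spaces and generic conditions *)

Section PolynomialFunctions.
Variable K : fieldType.

Definition polyfun m n (f : 'M[K]_(m, n) -> K) : Prop :=
  exists p : mxpolyring K m n, forall X, mxeval p X = f X.

Definition polymap m n m' n' (phi : 'M[K]_(m, n) -> 'M[K]_(m', n')) : Prop :=
  forall i j, polyfun (fun X => phi X i j).

Lemma mpoly_ring_ind n (P : mpoly n K -> Prop) :
  (forall c, P (mpolyC n c)) -> (forall i, P (mpolyX K (mnm1 i))) ->
  (forall p q, P p -> P q -> P (p + q)) ->
  (forall p q, P p -> P q -> P (p * q)) -> forall p, P p.
Proof.
move=> PC PX PD PM p; rewrite [p]mpolyE.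
apply: (big_ind P) => [|//|m _]; first by rewrite -mpolyC0.
rewrite -mul_mpolyC; apply: (PM) => //; rewrite mpolyXE_id.
apply: (big_ind P) => [|//|i _]; first by rewrite -mpolyC1.
elim: (m i) => [|k IHk]; first by rewrite expr0 -mpolyC1.
by rewrite exprS; apply: PM.
Qed.

Section Eval.
Variables m n : nat.
Implicit Types (p q : mxpolyring K m n) (X V : 'M[K]_(m, n)).

Definition mxvar i j : mxpolyring K m n := mpolyX K (mnm1 (mxvec_index i j)).

Lemma mxevalC c X : mxeval (mpolyC (m * n) c) X = c.
Proof. exact: mevalC. Qed.
Lemma mxevalD p q X : mxeval (p + q) X = mxeval p X + mxeval q X.
Proof. exact: mevalD. Qed.
Lemma mxevalM p q X : mxeval (p * q) X = mxeval p X * mxeval q X.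
Proof. exact: mevalM. Qed.
Lemma mxevalX i j X : mxeval (mxvar i j) X = X i j.
Proof. by rewrite /mxeval mevalXU mxvecE. Qed.

Lemma mxdiffC c X V : mxdiff (mpolyC (m * n) c) X V = 0.
Proof.
rewrite /mxdiff big1 // => i _; rewrite big1 // => j _.
by rewrite mderivC /mxeval meval0 mul0r.
Qed.
Lemma mxdiffD p q X V : mxdiff (p + q) X V = mxdiff p X V + mxdiff q X V.
Proof.
rewrite /mxdiff -big_split; apply: eq_bigr => i _.
rewrite -big_split; apply: eq_bigr => j _.
by rewrite mderivD mxevalD mulrDl.
Qed.
Lemma mxdiffM p q X V :
  mxdiff (p * q) X V = mxdiff p X V * mxeval q X + mxeval p X * mxdiff q X V.
Proof.
rewrite /mxdiff big_distrl big_distrr -big_split; apply: eq_bigr => i _.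
rewrite /= big_distrl big_distrr -big_split; apply: eq_bigr => j _ /=.
by rewrite mderivM mxevalD !mxevalM; ring.
Qed.
Lemma mxdiffX i j X V : mxdiff (mxvar i j) X V = V i j.
Proof.
have E k l : mxeval (mderiv (mxvec_index k l)
     (mxvar i j)) X
     = ((k == i) && (l == j))%:R.
  rewrite mderivX mnm1E /mxeval mevalZ.
  rewrite /mxvec_index (inj_eq (@cast_ord_inj _ _ _)) (inj_eq enum_rank_inj).
  rewrite xpair_eqE.
  rewrite -!/(mxvec_index _ _) (eq_sym i) (eq_sym j).
  case: andP => [[/eqP -> /eqP ->]|_]; last by rewrite mul0r.
  have -> : mnm_sub (mnm1 (mxvec_index i j)) (mnm1 (mxvec_index i j)) = mnm0.
    by apply/mnmP => u; rewrite mnmBE mnm0E subnn.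
  by rewrite mpolyX0 meval1 mulr1.
rewrite /mxdiff (bigD1 i) //= (bigD1 j) //= E !eqxx mul1r.
rewrite big1 ?addr0 => [|l /negPf lj]; last by rewrite E lj andbF mul0r.
rewrite big1 ?addr0 // => k /negPf ki; rewrite big1 // => l _.
by rewrite E ki mul0r.
Qed.

Lemma mxpoly_ind (P : mxpolyring K m n -> Prop) :
  (forall c, P (mpolyC (m * n) c)) ->
  (forall i j, P (mxvar i j)) ->
  (forall p q, P p -> P q -> P (p + q)) ->
  (forall p q, P p -> P q -> P (p * q)) -> forall p, P p.
Proof.
by move=> PC PX PD PM; apply: mpoly_ring_ind => // k; case/mxvec_indexP: k.
Qed.

(** The differential along [V] as the derivative of a polynomial in one
    variable. *)
Lemma mxdiff_line p X V : exists2 q : {poly K},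
  forall x, q.[x] = mxeval p (X + x *: V) & (q^`()).[0] = mxdiff p X V.
Proof.
elim/mxpoly_ind: p => [c|i j|p q [f fE fd] [g gE gd]|p q [f fE fd] [g gE gd]].
- by exists c%:P => [x|]; rewrite ?hornerC ?mxevalC // derivC horner0 mxdiffC.
- exists ((V i j)%:P * 'X + (X i j)%:P) => [x|]; last first.
    by rewrite derivD derivM !derivC derivX mxdiffX !hornerE.
  by rewrite mxevalX !mxE !hornerE; ring.
- exists (f + g) => [x|]; first by rewrite mxevalD hornerD fE gE.
  by rewrite derivD hornerD fd gd mxdiffD.
- exists (f * g) => [x|]; first by rewrite mxevalM hornerM fE gE.
  by rewrite derivM hornerD !hornerM fd gd fE gE scale0r addr0 mxdiffM.
Qed.

Lemma polyfun_line f X V : polyfun f ->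
  exists q : {poly K}, forall x, q.[x] = f (X + x *: V).
Proof.
by case=> p pf; have [q qE _] := mxdiff_line p X V; exists q => x; rewrite qE pf.
Qed.

Lemma eq_polyfun (f g : 'M[K]_(m, n) -> K) : polyfun f -> f =1 g -> polyfun g.
Proof. by move=> pf /funext <-. Qed.

Lemma polyfun_cst c : @polyfun m n (fun=> c).
Proof. by exists (mpolyC _ c) => X; rewrite mxevalC. Qed.
Lemma polyfunX i j : @polyfun m n (fun X => X i j).
Proof. by exists (mxvar i j) => X; rewrite mxevalX. Qed.
Lemma polyfunD (f g : 'M[K]_(m, n) -> K) :
  polyfun f -> polyfun g -> polyfun (fun X => f X + g X).
Proof. by case=> p pf [q qg]; exists (p + q) => X; rewrite mxevalD pf qg. Qed.
Lemma polyfunM (f g : 'M[K]_(m, n) -> K) :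
  polyfun f -> polyfun g -> polyfun (fun X => f X * g X).
Proof. by case=> p pf [q qg]; exists (p * q) => X; rewrite mxevalM pf qg. Qed.
Lemma polyfunN (f : 'M[K]_(m, n) -> K) : polyfun f -> polyfun (fun X => - f X).
Proof.
case=> p pf; exists (mpolyC _ (-1) * p) => X.
by rewrite mxevalM mxevalC mulN1r pf.
Qed.
Lemma polyfunB (f g : 'M[K]_(m, n) -> K) :
  polyfun f -> polyfun g -> polyfun (fun X => f X - g X).
Proof. by move=> pf pg; apply: polyfunD => //; apply: polyfunN. Qed.

Lemma polyfun_sum (I : Type) (r : seq I) (P : pred I)
    (F : I -> 'M[K]_(m, n) -> K) :
  (forall i, P i -> polyfun (F i)) -> polyfun (fun X => \sum_(i <- r | P i) F i X).
Proof.
move=> pF; elim: r => [|i r IHr].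
  by apply: eq_polyfun (polyfun_cst 0) _ => X; rewrite big_nil.
have [Pi|nPi] := boolP (P i); last first.
  by apply: eq_polyfun IHr _ => X; rewrite big_cons (negPf nPi).
by apply: eq_polyfun (polyfunD (pF i Pi) IHr) _ => X; rewrite big_cons Pi.
Qed.

Lemma polyfun_prod (I : Type) (r : seq I) (P : pred I)
    (F : I -> 'M[K]_(m, n) -> K) :
  (forall i, P i -> polyfun (F i)) -> polyfun (fun X => \prod_(i <- r | P i) F i X).
Proof.
move=> pF; elim: r => [|i r IHr].
  by apply: eq_polyfun (polyfun_cst 1) _ => X; rewrite big_nil.
have [Pi|nPi] := boolP (P i); last first.
  by apply: eq_polyfun IHr _ => X; rewrite big_cons (negPf nPi).
by apply: eq_polyfun (polyfunM (pF i Pi) IHr) _ => X; rewrite big_cons Pi.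
Qed.

Lemma polyfun_det k (phi : 'M[K]_(m, n) -> 'M[K]_k) :
  polymap phi -> polyfun (fun X => \det (phi X)).
Proof.
move=> pphi; apply: polyfun_sum => s _; apply: polyfunM; first exact: polyfun_cst.
by apply: polyfun_prod => i _; apply: pphi.
Qed.

Lemma polyfun_trace k (phi : 'M[K]_(m, n) -> 'M[K]_k) :
  polymap phi -> polyfun (fun X => \tr (phi X)).
Proof. by move=> pphi; apply: polyfun_sum => i _; apply: pphi. Qed.

Lemma polymap_cst k l (A : 'M[K]_(k, l)) : @polymap m n k l (fun=> A).
Proof. by move=> i j; apply: polyfun_cst. Qed.

Lemma polymap_id : @polymap m n m n id.
Proof. by move=> i j; apply: polyfunX. Qed.

Lemma polymap_tr k l (phi : 'M[K]_(m, n) -> 'M[K]_(k, l)) :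
  polymap phi -> polymap (fun X => (phi X)^T).
Proof. by move=> pphi i j; apply: eq_polyfun (pphi j i) _ => X; rewrite mxE. Qed.

Lemma polymap_mul k l l' (phi : 'M[K]_(m, n) -> 'M[K]_(k, l))
    (psi : 'M[K]_(m, n) -> 'M[K]_(l, l')) :
  polymap phi -> polymap psi -> polymap (fun X => phi X *m psi X).
Proof.
move=> pphi ppsi i j.
have := polyfun_sum (index_enum _)
  (fun u (_ : xpredT u) => polyfunM (pphi i u) (ppsi u j)).
by move/eq_polyfun; apply=> X; rewrite mxE.
Qed.

Lemma polymap_exp k (phi : 'M[K]_(m, n) -> 'M[K]_k) e :
  polymap phi -> polymap (fun X => phi X ^+ e).
Proof.
move=> pphi; elim: e => [|e IHe].
  by move=> i j; apply: eq_polyfun (polymap_cst 1 i j) _ => X; rewrite expr0.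
have -> : (fun X => phi X ^+ e.+1) = (fun X => phi X *m phi X ^+ e).
  by apply/funext => X; rewrite exprS.
exact: polymap_mul.
Qed.

End Eval.
Arguments polyfun_cst {m n} c.
Arguments polyfunX {m n} i j.
Arguments polymap_cst {m n k l} A.
Arguments polymap_id {m n}.

Lemma polyfun_comp m n k l (f : 'M[K]_(k, l) -> K)
    (phi : 'M[K]_(m, n) -> 'M[K]_(k, l)) :
  polyfun f -> polymap phi -> polyfun (fun X => f (phi X)).
Proof.
case=> p /funext <- pphi.
elim/mxpoly_ind: p => [c|i j|p q IHp IHq|p q IHp IHq].
- by apply: eq_polyfun (polyfun_cst c) _ => X; rewrite mxevalC.
- by apply: eq_polyfun (pphi i j) _ => X; rewrite mxevalX.
- by apply: eq_polyfun (polyfunD IHp IHq) _ => X; rewrite mxevalD.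
- by apply: eq_polyfun (polyfunM IHp IHq) _ => X; rewrite mxevalM.
Qed.

End PolynomialFunctions.
Arguments polyfun_cst {K m n} c.
Arguments polyfunX {K m n} i j.
Arguments polymap_cst {K m n k l} A.
Arguments polymap_id {K m n}.

Section GenericConditions.
Variable K : numFieldType.

Lemma poly_zero_everywhere (q : {poly K}) : (forall x, q.[x] = 0) -> q = 0.
Proof.
move=> q0; apply/eqP; apply: contraT => qn0.
have := @max_poly_roots _ q [seq i%:R | i <- iota 0 (size q)] qn0.
rewrite size_map size_iota ltnn => H'; suff : false by [].
apply: H'; first by apply/allP => x _; apply/eqP.
by rewrite map_inj_uniq ?iota_uniq //; apply: mulrIn; apply: oner_neq0.
Qed.

(** Two nonempty principal open sets meet already on the line through a point
    of each: there they are the nonvanishing sets of two nonzero polynomials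
    in one variable. *)
Lemma polyfun_common_nonzero m n (f g : 'M[K]_(m, n) -> K) X Y :
  polyfun f -> polyfun g -> f X != 0 -> g Y != 0 ->
  exists x, f (X + x *: (Y - X)) != 0 /\ g (X + x *: (Y - X)) != 0.
Proof.
move=> /(polyfun_line X (Y - X))[p pf] /(polyfun_line X (Y - X))[q qg] fX gY.
have p0 : p != 0.
  apply: contra fX => /eqP p0; have := pf 0.
  by rewrite p0 horner0 scale0r addr0 => <-.
have q0 : q != 0.
  apply: contra gY => /eqP q0; have := qg 1.
  by rewrite q0 horner0 scale1r addrC subrK => <-.
have pq0 : p * q != 0 by rewrite mulf_neq0.
have [x pqx] : exists x, (p * q).[x] != 0.
  apply: contrapT => /forallNP pq_eq0; case/eqP: pq0.
  by apply: poly_zero_everywhere => x; apply/eqP/negPn/negP/pq_eq0.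
by exists x; rewrite -pf -qg; apply/andP; rewrite -negb_or -mulf_eq0 -hornerM.
Qed.

Definition generic m n (P : 'M[K]_(m, n) -> Prop) : Prop :=
  exists2 f : 'M[K]_(m, n) -> K, polyfun f /\ (exists U, f U != 0) &
    forall U, f U != 0 -> P U.

Lemma genericW m n (P Q : 'M[K]_(m, n) -> Prop) :
  (forall U, P U -> Q U) -> generic P -> generic Q.
Proof. by move=> PQ [f f0 fP]; exists f => // U /fP; apply: PQ. Qed.

Lemma genericT m n (P : 'M[K]_(m, n) -> Prop) : (forall U, P U) -> generic P.
Proof.
move=> allP; exists (fun=> 1) => //; split; first exact: polyfun_cst.
by exists 0; apply: oner_neq0.
Qed.

Lemma genericI m n (P Q : 'M[K]_(m, n) -> Prop) :
  generic P -> generic Q -> generic (fun U => P U /\ Q U).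
Proof.
move=> [f [pf [X fX]] fP] [g [pg [Y gY]] gQ].
exists (fun U => f U * g U); last first.
  by move=> U; rewrite mulf_eq0 negb_or => /andP[/fP PU /gQ QU].
split; first exact: polyfunM.
have [x [fx gx]] := polyfun_common_nonzero pf pg fX gY.
by exists (X + x *: (Y - X)); rewrite mulf_neq0.
Qed.

Lemma generic_forall m n (I : finType) (P : I -> 'M[K]_(m, n) -> Prop) :
  (forall i, generic (P i)) -> generic (fun U => forall i, P i U).
Proof.
move=> gP.
suff : generic (fun U => forall i, i \in enum I -> P i U).
  by apply: genericW => U PU i; apply: PU; rewrite mem_enum.
elim: (enum I) => [|i s IHs]; first exact: genericT.
apply: genericW (genericI (gP i) IHs) => U [Pi Ps] j.
by rewrite inE => /predU1P[->|/Ps].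
Qed.

(** The right inverse [psi] carries a point where the condition holds to the
    source of [phi]; without it the image of [phi] could lie entirely in the
    exceptional hypersurface. *)
Lemma generic_pullback m n k l (phi : 'M[K]_(m, n) -> 'M[K]_(k, l))
    (psi : 'M[K]_(k, l) -> 'M[K]_(m, n)) (P : 'M[K]_(k, l) -> Prop) :
  polymap phi -> cancel psi phi -> generic P -> generic (fun U => P (phi U)).
Proof.
move=> pphi psiK [f [pf [X fX]] fP]; exists (fun U => f (phi U)).
  by split; [apply: polyfun_comp | exists (psi X); rewrite psiK].
by move=> U; apply: fP.
Qed.

End GenericConditions.

(** * Upper bound for chains of irreducible closed sets *)

Section AlgebraicDependence.
Variables (K : fieldType) (n : nat).

Lemma card_bmultinom w : (#|{: bmultinom n w.+1}| <= w.+1 ^ n)%N.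
Proof.
pose f (x : bmultinom n w.+1) : {ffun 'I_n -> 'I_w.+1} :=
  [ffun i => inord (bmnm x i)].
have coordlt (x : bmultinom n w.+1) i : (bmnm x i < w.+1)%N.
  apply: leq_trans (bmdeg x); rewrite ltnS mdegE (bigD1 i) //=.
  exact: leq_addr.
have injf : injective f.
  move=> x y /ffunP xy; apply/eqP; rewrite bmeqP; apply/eqP/mnmP => i.
  by have := congr1 val (xy i); rewrite !ffunE /= !inordK.
by have := leq_card f injf; rewrite card_ffun !card_ord.
Qed.

Lemma msizeM_le_deg (p q : mpoly n K) d e :
  (mmeasure mdeg p <= d.+1)%N -> (mmeasure mdeg q <= e.+1)%N ->
  (mmeasure mdeg (p * q) <= (d + e).+1)%N.
Proof.
have [->|p0] := eqVneq p 0; first by rewrite mul0r msize0.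
have [->|q0] := eqVneq q 0; first by rewrite mulr0 msize0.
move=> pd qe; rewrite msizeM // -ltnS prednK; last first.
  by rewrite addn_gt0 lt0n msize_poly_eq0 p0.
by apply: leq_trans (leq_add pd qe) _; rewrite addSn addnS.
Qed.

(** Counting monomials: the products of powers of the [p i] with all exponents
    below [M] number [M ^ n.+1], while their degrees grow linearly in [M], so
    that they lie in a space of dimension O([M ^ n]). *)
Lemma mpoly_algebraic_relation (p : 'I_n.+1 -> mpoly n K) :
  exists M (c : {ffun 'I_n.+1 -> 'I_M} -> K),
    (exists a, c a != 0) /\ \sum_a c a *: \prod_i p i ^+ a i = 0.
Proof.
pose e := (\max_i mmeasure mdeg (p i))%N.
(* This [M] makes [M ^ n.+1], the number of products, exceed
   [(M * (n.+1 * e).+1) ^ n], a bound for the number of monomials. *)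
pose M := ((n.+1 * e).+1 ^ n).+1; pose w := (n.+1 * (M * e))%N.
pose P (a : {ffun 'I_n.+1 -> 'I_M}) := \prod_i p i ^+ a i.
have Pw a : (mmeasure mdeg (P a) <= w.+1)%N.
  rewrite /w -[X in (X * _)%N]card_ord -sum_nat_const.
  rewrite /P; elim/big_ind2 : _ => [|x1 x2 y1 y2|i _]; first by rewrite msize1.
    exact: msizeM_le_deg.
  have pe : (mmeasure mdeg (p i) <= e.+1)%N.
    by apply: leqW; apply: (leq_bigmax i).
  suff H k : (mmeasure mdeg (p i ^+ k) <= (k * e).+1)%N.
    by apply: leq_trans (H _) _; rewrite ltnS leq_mul2r ltnW ?orbT.
  elim: k => [|k IHk]; first by rewrite expr0 msize1.
  by rewrite exprS mulSn; apply: msizeM_le_deg.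
pose A := \matrix_(i < #|{ffun 'I_n.+1 -> 'I_M}|, j < #|{: bmultinom n w.+1}|)
  mcoeff (bmnm (enum_val j)) (P (enum_val i)).
have rA : (\rank A < #|{ffun 'I_n.+1 -> 'I_M}|)%N.
  apply: leq_ltn_trans (rank_leq_col A) _.
  apply: leq_ltn_trans (card_bmultinom w) _.
  rewrite card_ffun !card_ord expnS.
  have wM : (w.+1 <= M * (n.+1 * e).+1)%N.
    by rewrite mulnS /w mulnCA -[X in (X < _)%N]add0n ltn_add2r.
  apply: leq_ltn_trans (_ : (M * (n.+1 * e).+1) ^ n < _)%N.
    by case: (n) wM => // k wM; rewrite leq_exp2r.
  by rewrite expnMn mulnC ltn_pmul2r ?expn_gt0.
have /rowV0Pn[v vA v0] : kermx A != 0 by rewrite -mxrank_eq0 mxrank_ker -lt0n subn_gt0.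
exists M, (fun a => v 0 (enum_rank a)); split.
  have /rV0Pn[i vi] := v0; by exists (enum_val i); rewrite enum_valK.
apply/mpolyP => m; rewrite mcoeff0 raddf_sum /=.
under eq_bigr do rewrite mcoeffZ.
have [mw|mw] := ltnP (mdeg m) w.+1; last first.
  rewrite big1 // => a _; rewrite (_ : mcoeff _ _ = 0) ?mulr0 //.
  apply: memN_msupp_eq0; apply: msize_mdeg_ge; exact: leq_trans (Pw a) mw.
have /sub_kermxP/rowP/(_ (enum_rank (BMultinom mw))) := vA.
rewrite !mxE => vA0; rewrite -[RHS]vA0 (reindex_onto enum_rank enum_val); last first.
  by move=> i _; rewrite enum_valK.
apply: eq_big => [a|a _]; first by rewrite enum_rankK eqxx.
by rewrite mxE !enum_rankK.
Qed.

End AlgebraicDependence.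

Section ChainBound.
Variables (K : fieldType) (m n : nat).
Implicit Types (A Z : set 'M[K]_(m, n)) (X Y : 'M[K]_(m, n)).

Lemma closed_separate Z Y : zariski_closed Z -> ~ Z Y ->
  exists p : mxpolyring K m n, (forall X, Z X -> mxeval p X = 0) /\ mxeval p Y != 0.
Proof.
case=> I -> /= /existsNP[p /not_implyP[Ip /eqP pY]].
by exists p; split => // X; apply.
Qed.

Lemma closed_zero_locus (f : 'M[K]_(m, n) -> K) :
  polyfun f -> zariski_closed [set X | f X = 0].
Proof.
case=> p pf; exists [set p]; apply/seteqP; split => X /= fX.
  by move=> _ ->; rewrite pf.
by rewrite -pf; apply: fX.
Qed.

Lemma irreducible_mul Z (f g : 'M[K]_(m, n) -> K) :
  zariski_irreducible Z -> polyfun f -> polyfun g ->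
  (forall X, Z X -> f X * g X = 0) ->
  (exists2 X, Z X & f X != 0) -> forall X, Z X -> g X = 0.
Proof.
case=> _ irrZ pf pg fg0 [Y ZY fY] X ZX.
have cov : Z `<=` [set X | f X = 0] `|` [set X | g X = 0].
  move=> W /fg0/eqP; rewrite mulf_eq0 => /orP[]/eqP ?; first by left.
  by right.
case: (irrZ _ _ (closed_zero_locus pf) (closed_zero_locus pg) cov) => sub.
  by case/negP: fY; apply/eqP/sub.
exact: sub.
Qed.

Lemma polyfun_exp (f : 'M[K]_(m, n) -> K) e :
  polyfun f -> polyfun (fun X => f X ^+ e).
Proof.
move=> pf; elim: e => [|e IHe].
  by apply: eq_polyfun (polyfun_cst 1) _ => X; rewrite expr0.
by apply: eq_polyfun (polyfunM pf IHe) _ => X; rewrite exprS.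
Qed.

(** Going down the chain, divide the relation on [Z k.+1] by the largest
    possible power of [f k], which is allowed since [Z k.+1] is irreducible,
    and then restrict it to [Z k], where [f k] vanishes and only the monomials
    of lowest degree in [f k] survive.  What is left on [Z 0] is a nonzero
    constant times [h]. *)
Lemma no_relation_along_chain r M (Z : nat -> set 'M[K]_(m, n))
    (f : 'I_r -> 'M[K]_(m, n) -> K) (h : 'M[K]_(m, n) -> K) X
    (c : {ffun 'I_r -> 'I_M} -> K) :
  (forall k, (k <= r)%N -> zariski_irreducible (Z k)) ->
  (forall k, (k < r)%N -> Z k `<=` Z k.+1) ->
  (forall i, polyfun (f i)) ->
  (forall (i : 'I_r) Y, Z i Y -> f i Y = 0) ->
  (forall i : 'I_r, exists2 Y, Z i.+1 Y & f i Y != 0) ->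
  polyfun h -> Z 0%N X -> h X != 0 -> (exists a, c a != 0) ->
  ~ (forall Y, Z r Y -> h Y * \sum_a c a * \prod_i f i Y ^+ a i = 0).
Proof.
move=> irrZ subZ pf f0 f1 ph ZX hX [a0 ca0] rel.
pose mono k (a : {ffun 'I_r -> 'I_M}) Y := \prod_(i < r | (i < k)%N) f i Y ^+ a i.
have pmono k a : polyfun (mono k a).
  by apply: polyfun_prod => i _; apply: polyfun_exp.
(* After the steps down to [Z k] the exponents of [f i] with [k <= i] are the
   same in all surviving monomials; for [k = 0] one monomial is left. *)
pose inv k := exists T : {set {ffun 'I_r -> 'I_M}},
  [/\ exists a, a \in T, forall a, a \in T -> c a != 0,
      forall (a b : {ffun 'I_r -> 'I_M}) (i : 'I_r),
        a \in T -> b \in T -> (k <= i)%N -> a i = b i &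
      forall Y, Z k Y -> h Y * \sum_(a in T) c a * mono k a Y = 0].
suff inv0 : inv 0%N.
  have [T [[a aT] cT eqT /(_ X ZX)/eqP]] := inv0.
  have -> : T = [set a]%SET.
    apply/setP => b; rewrite inE; apply/idP/eqP => [bT|->//].
    by apply/ffunP => i; apply: eqT.
  by rewrite big_set1 /mono big_pred0 // mulr1 mulf_eq0 (negPf hX) (negPf (cT a aT)).
have invr : inv r.
  exists [set a | c a != 0]%SET; split=> [|a|a b i _ _|Y ZY].
  - by exists a0; rewrite inE.
  - by rewrite inE.
  - by rewrite leqNgt ltn_ord.
  rewrite -[RHS](rel _ ZY) (bigID (fun a => c a != 0) predT) /=.
  rewrite [X in _ + X]big1 ?addr0 => [|a]; last first.
    by rewrite negbK => /eqP ->; rewrite mul0r.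
  congr (_ * _); apply: eq_big => [a|a _]; first by rewrite inE.
  by congr (_ * _); apply: eq_bigl => i; rewrite ltn_ord.
have step k : (k < r)%N -> inv k.+1 -> inv k.
  move=> kr [T [[a1 a1T] cT eqT relT]]; pose j := Ordinal kr.
  case: (@arg_minnP _ a1 (mem T) (fun a => a j) a1T) => a2 a2T' a2min.
  have a2T : a2 \in T := a2T'.
  exists [set a in T | a j == a2 j]%SET; split=> [|a|a b i|Y ZY].
  - by exists a2; rewrite inE a2T eqxx.
  - by rewrite inE => /andP[/cT].
  - rewrite !inE => /andP[aT /eqP aj] /andP[bT /eqP bj].
    rewrite leq_eqVlt => /predU1P[ki|]; last exact: eqT.
    by have -> : i = j by [apply: val_inj]; rewrite aj bj.
  pose g Y := h Y * \sum_(a in T) c a * (f j Y ^+ (a j - a2 j) * mono k a Y).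
  have pg : polyfun g.
    apply: polyfunM => //; apply: polyfun_sum => a _.
    apply: polyfunM; first exact: polyfun_cst.
    by apply: polyfunM => //; apply: polyfun_exp.
  have fg0 W : Z k.+1 W -> f j W ^+ a2 j * g W = 0.
    move=> /relT <-; rewrite /g mulrCA; congr (_ * _); rewrite mulr_sumr.
    apply: eq_bigr => a aT; rewrite mulrCA; congr (_ * _).
    rewrite mulrA -exprD subnKC ?a2min //.
    rewrite /mono [RHS](bigD1 j) //=; congr (_ * _).
    by apply: eq_bigl => i; rewrite ltnS ltn_neqAle andbC.
  have [W ZW fW] := f1 j.
  have fW' : f j W ^+ a2 j != 0 by rewrite expf_neq0.
  have := irreducible_mul (irrZ _ kr) (polyfun_exp (a2 j) (pf j)) pg fg0
    (ex_intro2 _ _ W ZW fW') (subZ _ kr _ ZY).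
  move=> gY0; rewrite -[RHS]gY0 /g; congr (_ * _).
  rewrite [RHS](bigID (fun a : {ffun 'I_r -> 'I_M} => a j == a2 j)) /=.
  rewrite [X in _ = _ + X]big1 ?addr0 => [|a /andP[aT naj]]; last first.
    rewrite (f0 j) // expr0n subn_eq0 leqNgt ltn_neqAle a2min // andbT eq_sym.
    by rewrite (inj_eq val_inj) (negPf naj) /= mul0r mulr0.
  apply: eq_big => [a|a]; rewrite inE // => /andP[_ /eqP ->].
  by rewrite subnn expr0 mul1r.
suff H k : (k <= r)%N -> inv (r - k)%N by rewrite -(subnn r); apply: H.
elim: k => [|k IHk] kr; first by rewrite subn0.
apply: step; first by rewrite ltn_subrL (leq_ltn_trans _ kr).
by rewrite -subSn // subSS; apply: IHk; rewrite ltnW.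
Qed.

(** The inequality dim <= D for a set that is parametrized, off the zeros of
    [h], by [D] coordinates.  Pick [f i] vanishing on [Z i] but not on
    [Z i.+1].  If the chain had more than [D] steps, the pullbacks of the [f i]
    along [phi] would be more than [D] polynomials in [D] variables, hence
    algebraically dependent. *)
Lemma irreducible_chain_le D A X (h : 'M[K]_(m, n) -> K)
    (phi : 'M[K]_(1, D) -> 'M[K]_(m, n)) e :
  polyfun h -> polymap phi -> h X != 0 ->
  (forall Y, A Y -> h Y != 0 -> exists t, Y = phi t) ->
  irreducible_chain A X e -> (e <= D)%N.
Proof.
move=> ph pphi hX cover [Z [ZA Zlt]]; rewrite leqNgt; apply/negP => De.
pose r := (1 * D).+1.
have ler k : (k <= r)%N -> (k <= e)%N.
  by move/leq_trans; apply; rewrite /r mul1n.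
have sepZ (i : 'I_r) : exists p : mxpolyring K m n,
    (forall Y, Z i Y -> mxeval p Y = 0) /\ (exists2 Y, Z i.+1 Y & mxeval p Y != 0).
  have /Zlt[ZiS] : (i < e)%N by apply: ler.
  move=> /existsNP[Y /not_implyP[ZY nZY]].
  have [clZ _ _ _] := ZA i (ler i (ltnW (ltn_ord i))).
  by have [p [p0 pY]] := closed_separate clZ nZY; exists p; split => //; exists Y.
have [f fP] := choice sepZ; pose F i Y := mxeval (f i) Y.
have pF i : polyfun (F i) by exists (f i).
have pbF (i : 'I_r) : exists q : mxpolyring K 1 D,
    forall t, mxeval q t = F i (phi t) := polyfun_comp (pF i) pphi.
have [q qF] := choice pbF.
have [M [c [c0 rel]]] := mpoly_algebraic_relation q.
have [_ _ ZrA _] := ZA r (ler r (leqnn r)).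
have [_ _ _ Z0X] := ZA 0%N isT.
apply: (@no_relation_along_chain r M Z F h X c) => //.
- by move=> k /ler/ZA[].
- by move=> k /ler/Zlt[].
- by move=> i; case: (fP i).
- by move=> i; case: (fP i).
move=> Y /ZrA AY; have [->|hY] := eqVneq (h Y) 0; first by rewrite mul0r.
have [t ->] := cover Y AY hY.
have := congr1 (fun p : mxpolyring K 1 D => mxeval p t) rel.
rewrite /mxeval meval0 raddf_sum /= => rel0.
rewrite (_ : \sum_a _ = 0) ?mulr0 // -[RHS]rel0; apply: eq_bigr => a _.
rewrite mevalZ rmorph_prod; congr (_ * _); apply: eq_bigr => i _.
by rewrite rmorphXn /= -qF.
Qed.

End ChainBound.

(** * Lower bound for chains of irreducible closed sets *)

Section ChainOfChart.
Variable K : numFieldType.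

Section Closure.
Variables m n : nat.
Implicit Types (A B : set 'M[K]_(m, n)).

Definition zclosure B : set 'M[K]_(m, n) :=
  [set Y | forall p, vanishing_ideal B p -> mxeval p Y = 0].

Lemma zclosure_closed B : zariski_closed (zclosure B).
Proof. by exists (vanishing_ideal B). Qed.

Lemma sub_zclosure B : B `<=` zclosure B.
Proof. by move=> X BX p; apply. Qed.

Lemma zclosure_sub A B : zariski_closed A -> B `<=` A -> zclosure B `<=` A.
Proof. by case=> I -> BI Y BY p Ip; apply: BY => X /BI; apply. Qed.

Lemma zclosure_zero B (f : 'M[K]_(m, n) -> K) Y :
  polyfun f -> (forall X, B X -> f X = 0) -> zclosure B Y -> f Y = 0.
Proof.
by move=> [p pf] f0 BY; rewrite -pf; apply: BY => X BX; rewrite pf f0.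
Qed.

(** If two closed sets do not contain the image of [L], then neither do they
    cover it: two polynomials that are nonzero somewhere on [L] are both nonzero
    at some point of a line in [L]. *)
Lemma zclosure_image_irreducible k l (phi : 'M[K]_(k, l) -> 'M[K]_(m, n))
    (L : set 'M[K]_(k, l)) :
  polymap phi -> L !=set0 -> (forall s t x, L s -> L t -> L (s + x *: (t - s))) ->
  zariski_irreducible (zclosure (phi @` L)).
Proof.
move=> pphi [t0 Lt0] Lline; split.
  by exists (phi t0); apply: sub_zclosure; exists t0.
have nsub C : zariski_closed C -> ~ zclosure (phi @` L) `<=` C ->
    exists f, [/\ polyfun f, forall X, C X -> f X = 0 &
                  exists2 t, L t & f (phi t) != 0].
  move=> clC nC; have [t Lt nCt] : exists2 t, L t & ~ C (phi t).
    apply: contrapT => H; apply: nC; apply: (zclosure_sub clC) => _ [t Lt <-].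
    by apply: contrapT => nCt; apply: H; exists t.
  have [p [p0 pt]] := closed_separate clC nCt.
  by exists (mxeval p); split=> //; [exists p | exists t].
move=> A B clA clB sAB; apply: contrapT => /not_orP[].
move=> /(nsub _ clA)[f [pf fA [s Ls fs]]] /(nsub _ clB)[g [pg gB [t Lt gt]]].
have [x []] := polyfun_common_nonzero (polyfun_comp pf pphi)
  (polyfun_comp pg pphi) fs gt.
set u := (s + _) => fu gu; have Zu : zclosure (phi @` L) (phi u).
  by apply: sub_zclosure; exists u => //; apply: Lline.
by case: (sAB _ Zu) => [/fA|/gB] /eqP; apply/negP.
Qed.

End Closure.

(** The inequality D <= dim at a point with coordinates: freeing the
    coordinates of [t0] one after the other gives a chain of closures of images
    of affine subspaces.  The function [psi i] detects that the [i]-th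
    coordinate has moved, so that the inclusions are strict. *)
Lemma irreducible_chain_of_chart m n D (A : set 'M[K]_(m, n))
    (phi : 'M[K]_(1, D) -> 'M[K]_(m, n)) (t0 : 'M[K]_(1, D))
    (psi : 'I_D -> 'M[K]_(m, n) -> K) :
  zariski_closed A -> polymap phi -> (forall t, A (phi t)) ->
  (forall i, polyfun (psi i)) ->
  (forall i (t : 'M[K]_(1, D)), t 0 i = t0 0 i -> psi i (phi t) = 0) ->
  (forall i, psi i (phi (t0 + delta_mx 0 i)) != 0) ->
  irreducible_chain A (phi t0) D.
Proof.
move=> clA pphi Aphi ppsi psi0 psi1.
pose L k : set 'M[K]_(1, D) := [set t | forall i : 'I_D, (k <= i)%N -> t 0 i = t0 0 i].
exists (fun k => zclosure (phi @` L k)); split=> [k _|k kD].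
  split; first exact: zclosure_closed.
  - apply: zclosure_image_irreducible => //; first by exists t0.
    by move=> s t x Ls Lt i ki; rewrite !mxE Ls // Lt // subrr mulr0 addr0.
  - by apply: (zclosure_sub clA) => _ [t _ <-].
  - by apply: sub_zclosure; exists t0.
pose i := Ordinal kD; split.
  apply: (zclosure_sub (@zclosure_closed _ _ _)) => _ [t Lt <-].
  apply: sub_zclosure; exists t => // j kj.
  by apply: Lt; apply: ltnW.
move=> sub; have : zclosure (phi @` L k) (phi (t0 + delta_mx 0 i)).
  apply: sub; apply: sub_zclosure; exists (t0 + delta_mx 0 i) => // j kj.
  by rewrite !mxE eqxx /= -(inj_eq val_inj) /= gtn_eqF // addr0.
move=> /(zclosure_zero (ppsi i)) H; case/negP: (psi1 i); apply/eqP/H.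
by move=> _ [t Lt <-]; apply: psi0; apply: Lt.
Qed.

End ChainOfChart.

(** * Cyclic vectors and simple spectra of symmetric matrices *)

Section CyclicVectors.
Variables (F : fieldType) (n' : nat).
Local Notation n := n'.+1.
Implicit Types (N : 'M[F]_n) (u v w x a : 'cV[F]_n) (g : {poly F}).

Definition dot k (u v : 'cV[F]_k) : F := (u^T *m v) 0 0.

Lemma dotE k (u v : 'cV[F]_k) : dot u v = \sum_i u i 0 * v i 0.
Proof. by rewrite /dot mxE; apply: eq_bigr => i _; rewrite mxE. Qed.

Lemma dotC k (u v : 'cV[F]_k) : dot u v = dot v u.
Proof. by rewrite !dotE; apply: eq_bigr => i _; rewrite mulrC. Qed.

Lemma dotZr k c (u v : 'cV[F]_k) : dot u (c *: v) = c * dot u v.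
Proof. by rewrite /dot -scalemxAr mxE. Qed.

Lemma dotBr k (u v w : 'cV[F]_k) : dot u (v - w) = dot u v - dot u w.
Proof. by rewrite /dot mulmxBr !mxE. Qed.

Lemma dot_delta k i (v : 'cV[F]_k) : dot (delta_mx i 0) v = v i 0.
Proof. by rewrite /dot trmx_delta -rowE mxE. Qed.

Lemma mul_tr_dot k (u v : 'cV[F]_k) : u^T *m v = (dot u v)%:M.
Proof. by rewrite [LHS]mx11_scalar. Qed.

Lemma dotMl k l (A : 'M[F]_(k, l)) (u : 'cV[F]_l) (v : 'cV[F]_k) :
  dot (A *m u) v = dot u (A^T *m v).
Proof. by rewrite /dot trmx_mul mulmxA. Qed.

Definition krylov N w : 'M[F]_n := \matrix_(i, j) (w^T *m N ^+ i) 0 j.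

Lemma krylov_mulE N w x i : (krylov N w *m x) i 0 = dot w (N ^+ i *m x).
Proof.
by rewrite /dot mulmxA !mxE; apply: eq_bigr => j _; rewrite !mxE.
Qed.

Lemma eigen_exp N a l i : N *m a = l *: a -> N ^+ i *m a = l ^+ i *: a.
Proof.
move=> Na; elim: i => [|i IHi]; first by rewrite !expr0 mul1mx scale1r.
by rewrite exprSr -mulmxA Na -scalemxAr IHi scalerA -exprS.
Qed.

(** A vector orthogonal to an eigenvector [a] has all its images under the
    powers of [N^T] orthogonal to [a] as well. *)
Lemma krylov_eigenvector N w a l : \det (krylov N w) != 0 ->
  N *m a = l *: a -> dot w a = 0 -> a = 0.
Proof.
move=> Kdet Na wa; apply/eqP; rewrite -trmx_eq0; apply: contraNT Kdet => a0.
rewrite -det_tr; apply/det0P; exists a^T => //.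
apply: trmx_inj; rewrite trmx_mul !trmxK trmx0; apply/colP => i.
by rewrite krylov_mulE (eigen_exp i Na) dotZr wa mulr0 mxE.
Qed.

(** With a cyclic coordinate vector, the eigenvectors for [l] form a line, so
    that the rows of g(N) are multiples of [a^T]. If [a] were isotropic, then
    [g.[l] *: a = g(N) a] would vanish. *)
Lemma simple_eigenvector_anisotropic N k a l g :
  N^T = N -> \det (krylov N (delta_mx k 0)) != 0 ->
  char_poly N = g * ('X - l%:P) -> g.[l] != 0 ->
  N *m a = l *: a -> a != 0 -> dot a a != 0.
Proof.
move=> symN Kdet chiN gl Na a0; set G := horner_mx N g.
have GN : G *m N = l *: G.
  have := Cayley_Hamilton N; rewrite chiN rmorphM rmorphB /= horner_mx_X.
  by rewrite horner_mx_C mulrBr => /subr0_eq GN; rewrite mulmxE GN -mulmxE mul_mx_scalar.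
have ak : a k 0 != 0.
  by apply: contra a0 => /eqP ak; rewrite (krylov_eigenvector Kdet Na) // dot_delta.
have Ga : G *m a = g.[l] *: a.
  rewrite /G; elim/poly_ind: (g) => [|h c IHh].
    by rewrite rmorph0 mul0mx horner0 scale0r.
  rewrite rmorphD rmorphM /= horner_mx_X horner_mx_C mulmxDl -mulmxA Na.
  rewrite -scalemxAr IHh.
  by rewrite mul_scalar_mx scalerA -scalerDl !hornerE mulrC.
apply: contraNneq gl => aa; suff : G *m a = 0.
  by rewrite Ga => /eqP; rewrite scaler_eq0 (negPf a0) orbF.
apply/colP => i; rewrite [RHS]mxE; pose r := (row i G)^T.
have Nr : N *m r = l *: r.
  rewrite -[N in LHS]symN /r -trmx_mul -row_mul GN.
  by apply/colP => j; rewrite !mxE.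
have ra : r = (r k 0 / a k 0) *: a.
  apply/eqP; rewrite -subr_eq0; apply/eqP; apply: (krylov_eigenvector (l := l) Kdet).
    by rewrite mulmxBr Nr -scalemxAr Na scalerBr !scalerA [l * _]mulrC.
  by rewrite dotBr dotZr !dot_delta divfK ?subrr.
have -> : (G *m a) i 0 = dot r a by rewrite /dot trmxK -row_mul [RHS]mxE.
by rewrite dotC ra dotZr aa mulr0.
Qed.

(** Write [B = C *m D] with [C] and [D] of full rank: then [D *m C = 0], and
    this product has the same trace as [B]. *)
Lemma trace_square0 (B : 'M[F]_n) : B *m B = 0 -> \tr B = 0.
Proof.
move=> BB; rewrite -[B]mulmx_base mxtrace_mulC.
suff -> : row_base B *m col_base B = 0 by rewrite mxtrace0.
apply: (row_free_inj (row_base_free B)); rewrite mul0mx.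
apply: (row_full_inj (col_base_full B)); rewrite mulmx0.
by rewrite mulmxA mulmxA mulmx_base -mulmxA mulmx_base.
Qed.

(** For a diagonal matrix this is the product of the Vandermonde matrix of
    the eigenvalues with its transpose, so that its determinant is the
    discriminant of the characteristic polynomial. *)
Definition power_traces N : 'M[F]_n := \matrix_(i, j) \tr (N ^+ (i + j)).

(** If [l] is a double root then, with chi = g (X - l), the matrix g(N) is a
    nonzero combination of the powers of [N] below the [n]-th, and it has
    square 0 since chi divides g^2.  So all the products [N ^+ i * g(N)] have
    trace 0. *)
Lemma power_traces_simple_root N l g : \det (power_traces N) != 0 ->
  char_poly N = g * ('X - l%:P) -> g.[l] != 0.
Proof.
move=> Hdet chiN; apply: contraNneq Hdet => /eqP/factor_theorem[h gE].
have g0 : g != 0.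
  apply: contraTneq (char_poly_monic N) => g0.
  by rewrite chiN g0 mul0r monicE lead_coef0 eq_sym oner_neq0.
have sg : size g = n.
  have := size_char_poly N; rewrite chiN size_Mmonic ?monicXsubC //.
  by rewrite size_XsubC addn2 /= => -[].
set G := horner_mx N g.
have GE : G = \sum_(i < n) g`_i *: N ^+ i.
  rewrite /G -{1}[g]coefK poly_def raddf_sum /= sg; apply: eq_bigr => i _.
  by rewrite linearZ /= rmorphXn /= horner_mx_X.
have GG : G * G = 0.
  by rewrite -rmorphM /= {2}gE mulrCA -chiN rmorphM /= Cayley_Hamilton mulr0.
apply/det0P; exists (\row_(i < n) g`_i).
  apply: contra g0 => /eqP /rowP gi; apply/eqP/polyP => i; rewrite coef0.
  have [ni|ni] := leqP n i; first by rewrite nth_default // sg.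
  by have := gi (Ordinal ni); rewrite !mxE.
apply/rowP => j; rewrite !mxE.
transitivity (\tr (N ^+ j *m G)).
  rewrite GE mulmx_sumr raddf_sum /=; apply: eq_bigr => i _.
  by rewrite !mxE -scalemxAr mxtraceZ mulmxE -exprD addnC.
apply: trace_square0; have cNG : GRing.comm (N ^+ j) G.
  by apply: GRing.commr_sym; apply: commrX; apply: comm_horner_mx.
by rewrite mulmxE -mulrA (mulrA G) -cNG -mulrA GG !mulr0.
Qed.

End CyclicVectors.

(** * Critical rank one matrices of a single matrix *)

Section CriticalPairs.
Variable K : numClosedFieldType.

(** These are the conditions that [M - X] be orthogonal to all tangent vectors
    [a *m y^T] and [x *m b^T] of the cone of matrices of rank one at
    [X = a *m b^T]. *)
Definition critical_rank1 p q (M X : 'M[K]_(p, q)) : Prop :=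
  exists a b, [/\ X = a *m b^T, X != 0,
    M^T *m a = dot a a *: b & M *m b = dot b b *: a].

(** The nonzero entries locate a critical point on exactly one component of the
    pattern variety. *)
Definition expected_critical p q (M : 'M[K]_(p, q)) : Prop :=
  (exists s : seq 'M[K]_(p, q), [/\ uniq s, size s = minn p q &
     forall X, critical_rank1 M X <-> X \in s]) /\
  (forall X, critical_rank1 M X -> forall i j, X i j != 0).

Section Wide.
Variables (p' q : nat).
Local Notation p := p'.+1.
Implicit Types M X : 'M[K]_(p, q).

Definition cyclic_gram M : Prop :=
  [/\ forall k, \det (krylov (M *m M^T) (delta_mx k 0)) != 0,
      forall l : 'I_q, \det (krylov (M *m M^T) (M *m delta_mx l 0)) != 0 &
      \det (power_traces (M *m M^T)) != 0].

Variable M : 'M[K]_(p, q).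
Hypotheses (pq : (p <= q)%N) (Mcyc : cyclic_gram M).
Local Notation N := (M *m M^T).

Lemma gram_sym : N^T = N.
Proof. by rewrite trmx_mul trmxK. Qed.

Lemma gram_spectrum : exists rs : seq K, [/\ uniq rs, size rs = p &
  forall l, l \in rs <-> exists2 a : 'cV[K]_p, N *m a = l *: a & a != 0].
Proof.
have [rs chiE] := closed_field_poly_normal (char_poly N).
rewrite (monicP (char_poly_monic N)) scale1r in chiE.
have [_ _ Hdet] := Mcyc; exists rs; split.
- apply: count_mem_uniq => z; have [zrs|] := boolP (z \in rs); last exact: count_memPn.
  have simple : (\prod_(y <- rem z rs) ('X - y%:P)).[z] != 0.
    apply: (power_traces_simple_root Hdet).
    by rewrite chiE (perm_big _ (perm_to_rem zrs)) big_cons mulrC.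
  rewrite (seq.permP (perm_to_rem zrs)) /= eqxx.
  suff /count_memPn -> : z \notin rem z rs by [].
  by move: simple; rewrite -[_ == 0]/(root _ _) root_prod_XsubC.
- by have := size_char_poly N; rewrite chiE size_prod_XsubC => -[].
move=> l; rewrite -root_prod_XsubC -chiE -eigenvalue_root_char.
split=> [/eigenvalueP[v vN v0]|[a Na a0]].
  exists v^T; last by rewrite trmx_eq0.
  by rewrite -[N in LHS]gram_sym -trmx_mul vN linearZ.
apply/eigenvalueP; exists a^T; last by rewrite trmx_eq0.
by rewrite -[N in LHS]gram_sym -trmx_mul Na linearZ.
Qed.

(** A vanishing coordinate is orthogonality to a cyclic vector: a coordinate
    vector for the coordinates of [a], a column of [M] for those of
    [M^T *m a]. *)
Lemma gram_eigenvector_coord l (a : 'cV[K]_p) : N *m a = l *: a -> a != 0 ->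
  (forall k, a k 0 != 0) /\ (forall j, (M^T *m a) j 0 != 0).
Proof.
case: Mcyc => rowcyc colcyc _ Na a0; split=> k; apply: contra a0 => /eqP ak.
  by rewrite (krylov_eigenvector (rowcyc k) Na) // dot_delta.
rewrite (krylov_eigenvector (colcyc k) Na) // /dot trmx_mul -mulmxA.
by rewrite -[LHS]/(dot _ _) dot_delta.
Qed.

Lemma gram_eigenvector_anisotropic l (a : 'cV[K]_p) :
  N *m a = l *: a -> a != 0 -> dot a a != 0.
Proof.
move=> Na a0; case: Mcyc => rowcyc _ Hdet.
have /factor_theorem[g chiE] : root (char_poly N) l.
  rewrite -eigenvalue_root_char; apply/eigenvalueP; exists a^T; last by rewrite trmx_eq0.
  by rewrite -[N in LHS]gram_sym -trmx_mul Na linearZ.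
apply: (simple_eigenvector_anisotropic gram_sym (rowcyc 0) chiE _ Na a0).
exact: power_traces_simple_root chiE.
Qed.

Lemma gram_eigenline l (a c : 'cV[K]_p) : N *m a = l *: a -> a != 0 -> N *m c = l *: c ->
  c = (c 0 0 / a 0 0) *: a.
Proof.
move=> Na a0 Nc; have [rowcyc _ _] := Mcyc.
have [/(_ 0) ak _] := gram_eigenvector_coord Na a0.
apply/eqP; rewrite -subr_eq0; apply/eqP; apply: (krylov_eigenvector (rowcyc 0) (l := l)).
  by rewrite mulmxBr Nc -scalemxAr Na scalerBr !scalerA [l * _]mulrC.
by rewrite dotBr dotZr !dot_delta divfK ?subrr.
Qed.

(** The image of [M] under the orthogonal projection onto the line of [a]. *)
Definition eigen_projection (a : 'cV[K]_p) : 'M[K]_(p, q) :=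
  (dot a a)^-1 *: (a *m a^T *m M).

Lemma eigen_projectionE a i j :
  eigen_projection a i j = (dot a a)^-1 * (a i 0 * (M^T *m a) j 0).
Proof.
rewrite mxE -mulmxA mxE big_ord_recl big_ord0 addr0; congr (_ * (_ * _)).
by rewrite -[in RHS](trmxK a) -trmx_mul [RHS]mxE.
Qed.

Lemma eigen_projection_critical l a : N *m a = l *: a -> a != 0 ->
  critical_rank1 M (eigen_projection a).
Proof.
move=> Na a0; have aa := gram_eigenvector_anisotropic Na a0.
have [ak Ma] := gram_eigenvector_coord Na a0.
have Mb : M *m (M^T *m a) = l *: a by rewrite mulmxA Na.
exists a, ((dot a a)^-1 *: (M^T *m a)); split.
- by rewrite /eigen_projection linearZ /= trmx_mul trmxK -scalemxAr mulmxA.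
- have [k _] : exists k : 'I_q, true by exists (Ordinal (leq_ltn_trans (leq0n p') pq)).
  have : eigen_projection a 0 k != 0.
    by rewrite eigen_projectionE !mulf_neq0 ?invr_neq0.
  by apply: contra => /eqP ->; rewrite mxE.
- by rewrite scalerA divff // scale1r.
- rewrite -scalemxAr Mb dotZr dotC dotZr dotMl trmxK Mb dotZr scalerA.
  by congr (_ *: _); field.
Qed.

Lemma critical_eigenvector X : critical_rank1 M X ->
  exists l a, [/\ N *m a = l *: a, a != 0 & X = eigen_projection a].
Proof.
move=> [a [b [XE X0 Ma Mb]]]; exists (dot a a * dot b b), a.
have Na : N *m a = (dot a a * dot b b) *: a.
  by rewrite -mulmxA Ma -scalemxAr Mb scalerA.
have a0 : a != 0 by apply: contraNneq X0 => a0; rewrite XE a0 mul0mx.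
have aa := gram_eigenvector_anisotropic Na a0.
split=> //; rewrite XE /eigen_projection -mulmxA.
have -> : a^T *m M = dot a a *: b^T.
  by rewrite -[M]trmxK -trmx_mul Ma linearZ.
by rewrite -scalemxAr scalerA mulVf // scale1r.
Qed.

(** Rank one critical points correspond to eigenvalues of [N]: the left
    multiplication by [N] scales a critical point by its eigenvalue, and the
    eigenline determines the critical point. *)
Lemma wide_expected_critical : expected_critical M.
Proof.
split; last first.
  move=> X /critical_eigenvector[l [a [Na a0 ->]]] i j.
  have [ak Ma] := gram_eigenvector_coord Na a0.
  have aa := gram_eigenvector_anisotropic Na a0.
  by rewrite eigen_projectionE !mulf_neq0 // invr_neq0.
have [rs [urs srs rsP]] := gram_spectrum.
have eigvec l : exists a : 'cV[K]_p, l \in rs -> N *m a = l *: a /\ a != 0.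
  have [/rsP[a Na a0]|] := boolP (l \in rs); first by exists a.
  by exists 0.
have [v vP] := choice eigvec.
have proj0 l : l \in rs -> eigen_projection (v l) != 0.
  by move=> /vP[Na a0]; have [? [? []]] := eigen_projection_critical Na a0.
have projN l : l \in rs -> N *m eigen_projection (v l) = l *: eigen_projection (v l).
  move=> /vP[Na a0]; rewrite /eigen_projection -scalemxAr !mulmxA.
  rewrite -[_ *m M^T *m v l]/(N *m v l) Na.
  by rewrite -!scalemxAl !scalerA mulrC.
exists [seq eigen_projection (v l) | l <- rs]; split.
- rewrite map_inj_in_uniq // => l l' lrs lrs' eqX.
  have := projN l lrs; rewrite eqX projN // => /eqP.
  by rewrite -subr_eq0 -scalerBl scaler_eq0 (negPf (proj0 _ lrs')) orbF subr_eq0 => /eqP.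
- by rewrite size_map srs; apply/esym/minn_idPl.
move=> X; split=> [/critical_eigenvector[l [a [Na a0 ->]]]|/mapP[l /vP[Na a0] ->]].
  have lrs : l \in rs by apply/rsP; exists a.
  apply/mapP; exists l => //; have [Nv v0] := vP l lrs.
  have vE := gram_eigenline Na a0 Nv; set c := (_ / _) in vE.
  have c0 : c != 0 by apply: contraNneq v0 => c0; rewrite vE c0 scale0r.
  have aa := gram_eigenvector_anisotropic Na a0.
  rewrite vE /eigen_projection dotZr dotC dotZr linearZ /= -!scalemxAl -scalemxAr -scalemxAl.
  by rewrite !scalerA; congr (_ *: _); field; rewrite c0 aa.
exact: eigen_projection_critical Na a0.
Qed.

End Wide.

Lemma critical_rank1_tr p q (M X : 'M[K]_(p, q)) :
  critical_rank1 M X -> critical_rank1 M^T X^T.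
Proof.
move=> [a [b [XE X0 Ma Mb]]]; exists b, a; split=> //.
- by rewrite XE trmx_mul trmxK.
- by rewrite trmx_eq0.
- by rewrite trmxK.
Qed.

Lemma expected_critical_tr p q (M : 'M[K]_(p, q)) :
  expected_critical M^T -> expected_critical M.
Proof.
move=> [[s [us ss sP]] nz]; split=> [|X /critical_rank1_tr/nz XT i j]; last first.
  by have := XT j i; rewrite mxE.
exists [seq X^T | X <- s]; split.
- by rewrite map_inj_uniq //; apply: trmx_inj.
- by rewrite size_map ss minnC.
move=> X; rewrite -[X in X \in _]trmxK mem_map; last exact: trmx_inj.
split; first by move/critical_rank1_tr/sP.
by move/sP/critical_rank1_tr; rewrite !trmxK.
Qed.

End CriticalPairs.

(** * Embedding blocks into matrices *)

Section Selection.
Variable K : fieldType.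

Section OneMap.
Variables p q : nat.
Implicit Type sigma : 'I_p -> 'I_q.

(** The coordinate projection along [sigma]; its transpose is the inclusion of
    the coordinate subspace indexed by the image of [sigma]. *)
Definition select_mx (sigma : 'I_p -> 'I_q) : 'M[K]_(p, q) :=
  \matrix_(i, j) (j == sigma i)%:R.

Lemma select_mxK sigma : injective sigma ->
  select_mx sigma *m (select_mx sigma)^T = 1%:M.
Proof.
move=> inj; apply/matrixP => i k; rewrite !mxE (bigD1 (sigma i)) //= !mxE eqxx.
rewrite big1 ?addr0 => [|j /negPf ji]; last by rewrite !mxE ji mul0r.
by rewrite mul1r (inj_eq inj).
Qed.

Lemma select_mx_delta sigma k : injective sigma ->
  select_mx sigma *m delta_mx (sigma k) 0 = delta_mx k 0 :> 'cV_p.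
Proof.
move=> inj; apply/matrixP => i j; rewrite -colE !mxE (inj_eq inj) eq_sym.
by rewrite ord1 eqxx andbT.
Qed.

Lemma gram_select (B : 'M[K]_p) sigma : injective sigma ->
  (B *m select_mx sigma) *m (B *m select_mx sigma)^T = B *m B^T.
Proof.
by move=> inj; rewrite trmx_mul mulmxA -(mulmxA B) select_mxK // mulmx1.
Qed.

End OneMap.

Section Block.
Variables (m n p q : nat) (r : 'I_p -> 'I_m) (c : 'I_q -> 'I_n).

Definition block_restrict (X : 'M[K]_(m, n)) : 'M[K]_(p, q) :=
  select_mx r *m X *m (select_mx c)^T.
Definition block_embed (Y : 'M[K]_(p, q)) : 'M[K]_(m, n) :=
  (select_mx r)^T *m Y *m select_mx c.

Lemma select_mx_mul l (X : 'M[K]_(m, l)) i j : (select_mx r *m X) i j = X (r i) j.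
Proof.
rewrite mxE (bigD1 (r i)) //= mxE eqxx mul1r big1 ?addr0 // => k /negPf ki.
by rewrite mxE ki mul0r.
Qed.

Lemma block_restrictE X i j : block_restrict X i j = X (r i) (c j).
Proof.
rewrite /block_restrict -mulmxA select_mx_mul mxE (bigD1 (c j)) //= !mxE eqxx mulr1.
by rewrite big1 ?addr0 // => k /negPf kj; rewrite !mxE kj mulr0.
Qed.

Lemma block_embedK : injective r -> injective c -> cancel block_embed block_restrict.
Proof.
move=> injr injc Y; rewrite /block_restrict /block_embed !mulmxA select_mxK //.
by rewrite mul1mx -mulmxA select_mxK // mulmx1.
Qed.

Lemma block_embed_out Y i j :
  (i \notin codom r) || (j \notin codom c) -> block_embed Y i j = 0.
Proof.
case/orP => [ir|jc].
  rewrite /block_embed -mulmxA mxE big1 // => k _; rewrite !mxE.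
  by case: eqP => [ik|_]; rewrite ?mul0r //; move: ir; rewrite ik codom_f.
rewrite mxE big1 // => k _; rewrite [X in _ * X]mxE.
by case: eqP => [jk|_]; rewrite ?mulr0 //; move: jc; rewrite jk codom_f.
Qed.

Lemma block_restrictK (X : 'M[K]_(m, n)) : injective r -> injective c ->
  (forall i j, (i \notin codom r) || (j \notin codom c) -> X i j = 0) ->
  block_embed (block_restrict X) = X.
Proof.
move=> injr injc X0; apply/matrixP => i j.
have [out|] := boolP ((i \notin codom r) || (j \notin codom c)).
  by rewrite block_embed_out // X0.
rewrite negb_or !negbK => /andP[/codomP[k ->] /codomP[l ->]].
by rewrite -!block_restrictE block_embedK.
Qed.

Lemma block_embed_rank1 (a : 'cV[K]_p) (b : 'cV[K]_q) :
  block_embed (a *m b^T) = ((select_mx r)^T *m a) *m ((select_mx c)^T *m b)^T.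
Proof. by rewrite /block_embed trmx_mul trmxK !mulmxA. Qed.

Lemma block_embedD Y Z : block_embed (Y + Z) = block_embed Y + block_embed Z.
Proof. by rewrite /block_embed mulmxDr mulmxDl. Qed.

Lemma block_embedZ x Y : block_embed (x *: Y) = x *: block_embed Y.
Proof. by rewrite /block_embed -scalemxAr -scalemxAl. Qed.

Lemma trace_block_embed (U : 'M[K]_(m, n)) Y :
  \tr (U *m (block_embed Y)^T) = \tr (block_restrict U *m Y^T).
Proof.
rewrite /block_embed /block_restrict !trmx_mul trmxK.
by rewrite -!mulmxA [RHS]mxtrace_mulC -!mulmxA.
Qed.

Lemma polymap_block_restrict : polymap block_restrict.
Proof.
apply: polymap_mul (polymap_cst _); apply: polymap_mul polymap_id.
exact: polymap_cst.
Qed.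

Lemma polymap_block_embed k l (phi : 'M[K]_(k, l) -> 'M[K]_(p, q)) :
  polymap phi -> polymap (fun X => block_embed (phi X)).
Proof.
move=> pphi; apply: polymap_mul (polymap_cst _); apply: polymap_mul pphi.
exact: polymap_cst.
Qed.

End Block.
End Selection.
Arguments select_mx {K p q} sigma.

(** * Genericity of the spectral conditions *)

Section GenericGram.
Variable K : numClosedFieldType.
Variables (p' q : nat).
Local Notation p := p'.+1.
Hypothesis pq : (p <= q)%N.

Lemma natr_sqr_inj : injective (fun i : 'I_p => (i.+1%:R : K) ^+ 2).
Proof.
move=> i j /eqP; rewrite -!natrX eqr_nat eqn_exp2r // eqSS => /eqP.
exact: val_inj.
Qed.

(** The Gram matrix is diagonal with distinct entries. *)
Lemma power_traces_witness : exists M : 'M[K]_(p, q),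
  \det (power_traces (M *m M^T)) != 0.
Proof.
pose d := \row_(i < p) (i.+1%:R : K); pose sigma := widen_ord pq.
have inj : injective sigma by move=> i j /(congr1 val) /= /val_inj.
exists (diag_mx d *m select_mx sigma); rewrite gram_select // tr_diag_mx mulmx_diag.
set d2 := \row__ _.
have powE e : diag_mx d2 ^+ e = diag_mx (\row_i d2 0 i ^+ e).
  elim: e => [|e IHe].
    by apply/matrixP => i j; rewrite expr0 !mxE expr0.
  rewrite exprS IHe -mulmxE mulmx_diag; congr diag_mx; apply/rowP => i.
  by rewrite !mxE exprS.
have -> : power_traces (diag_mx d2) = Vandermonde p d2 *m (Vandermonde p d2)^T.
  apply/matrixP => i j; rewrite !mxE powE mxtrace_diag; apply: eq_bigr => k _.
  by rewrite !mxE exprD.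
suff detV : \det (Vandermonde p d2) != 0 by rewrite det_mulmx det_tr mulf_neq0.
rewrite det_Vandermonde; apply/prodf_neq0 => i _; apply/prodf_neq0 => j ij.
rewrite subr_eq0 !mxE -!expr2; apply: contraL ij => /eqP/natr_sqr_inj ->.
by rewrite ltnn.
Qed.

Section Arrow.
Variable k : 'I_p.

(** Diagonal apart from row [k].  The only nonzero entry of column [k] is the
    one in row [k], so that its product with a selection matrix has the
    coordinate vector [k] as a column; one witness then serves both kinds of
    cyclic vectors. *)
Definition arrow_mx : 'M[K]_p :=
  \matrix_(i, j) if i == k then 1 else i.+1%:R * (i == j)%:R.

(** On vectors with vanishing [k]-th coordinate the Gram matrix of the arrow
    matrix acts diagonally, with distinct eigenvalues, outside row [k]. If its
    powers keep the [k]-th coordinate at zero, then evaluating the row [k] at a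
    Lagrange interpolation polynomial isolates each of the other coordinates. *)
Lemma arrow_krylov : \det (krylov (arrow_mx *m arrow_mx^T) (delta_mx k 0)) != 0.
Proof.
set N := _ *m _; pose d (i : 'I_p) : K := i.+1%:R.
rewrite -det_tr; apply/det0P => -[v v0 /(congr1 trmx)].
rewrite trmx_mul trmxK trmx0 => Kx; set x := v^T in Kx.
have NE i j : i != k -> j != k -> N i j = (d i ^+ 2) * (i == j)%:R.
  move=> ik jk; rewrite mxE (bigD1 i) //= !mxE (negPf ik) (negPf jk) eqxx /= mulr1n mulr1.
  rewrite big1 ?addr0 => [|u /negPf ui]; last first.
    by rewrite !mxE (negPf ik) (eq_sym i) ui mulr0 mul0r.
  by rewrite eq_sym; case: eqP => [->|_]; rewrite ?mulr0 // !mulr1 -expr2.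
have NkE j : j != k -> N k j = d j.
  move=> jk; rewrite mxE (bigD1 j) //= !mxE eqxx (negPf jk) mul1r eqxx /= mulr1n mulr1.
  rewrite big1 ?addr0 // => u /negPf uj.
  by rewrite !mxE (negPf jk) (eq_sym j) uj !mulr0.
have coordk i : (i < p)%N -> (N ^+ i *m x) k 0 = 0.
  move=> ip; have := krylov_mulE N (delta_mx k 0) x (Ordinal ip).
  by rewrite Kx mxE dot_delta => <-.
have powE i : (i < p)%N -> forall j, j != k -> (N ^+ i *m x) j 0 = (d j ^+ 2) ^+ i * x j 0.
  elim: i => [|i IHi] ip j jk; first by rewrite !expr0 mul1mx mul1r.
  rewrite exprS -mulmxE -mulmxA mxE (bigD1 k) //= coordk ?(ltnW ip) // mulr0 add0r.
  rewrite (bigD1 j) //= NE // eqxx mulr1 IHi ?(ltnW ip) // big1 ?addr0.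
    by rewrite [_ ^+ i.+1]exprS mulrA.
  by move=> u /andP[uk uj]; rewrite NE // eq_sym (negPf uj) mulr0 mul0r.
have rowk i : (i.+1 < p)%N -> \sum_(j | j != k) d j * ((d j ^+ 2) ^+ i * x j 0) = 0.
  move=> ip; rewrite -[RHS](coordk i.+1 ip) exprS -mulmxE -mulmxA [RHS]mxE.
  rewrite [RHS](bigD1 k) //= coordk ?(ltnW ip) // mulr0 add0r.
  by apply: eq_bigr => j jk; rewrite NkE // powE // ltnW.
(* Powers of degree up to p - 2 suffice for a Lagrange polynomial, which has
   one root for each index other than [j] and [k]. *)
have rowg (g : {poly K}) : (size g < p)%N ->
    \sum_(j | j != k) d j * (g.[d j ^+ 2] * x j 0) = 0.
  move=> gp; under eq_bigr => j _ do rewrite horner_coef mulr_suml mulr_sumr.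
  rewrite exchange_big big1 //= => i _.
  under eq_bigr => j _ do rewrite -mulrA mulrCA.
  by rewrite -mulr_sumr rowk ?mulr0 // (leq_ltn_trans _ gp) // ltn_ord.
case/eqP: v0; apply: trmx_inj; rewrite trmx0 -/x; apply/colP => j; rewrite [RHS]mxE.
have [->|jk] := eqVneq j k; first by have := coordk 0%N isT; rewrite mul1mx.
pose g := \prod_(u in [set~ k] :\ j) ('X - (d u ^+ 2)%:P).
have /rowg : (size g < p)%N.
  rewrite /g -big_enum size_prod_XsubC -cardE.
  have := cardsD1 j [set~ k]%SET; rewrite !inE jk cardsC1 card_ord add1n /= => pE.
  by rewrite -pE.
rewrite (bigD1 j) //= big1 ?addr0 => [/eqP|u /andP[uk uj]]; last first.
  rewrite /g horner_prod (bigD1 u) ?inE ?uk ?uj //= hornerXsubC subrr.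
  by rewrite !mul0r mulr0.
rewrite !mulf_eq0 pnatr_eq0 /= => /orP[/eqP gj|/eqP //].
suff /negP[] : g.[d j ^+ 2] != 0 by apply/eqP.
rewrite horner_prod; apply/prodf_neq0 => u; rewrite !inE => /andP[uj _].
rewrite hornerXsubC subr_eq0; apply: contra uj => /eqP/natr_sqr_inj ->.
by [].
Qed.

Lemma arrow_delta : arrow_mx *m delta_mx k 0 = delta_mx k 0 :> 'cV_p.
Proof.
apply/matrixP => i j; rewrite -colE !mxE ord1 eqxx andbT.
by case: eqP; rewrite ?mulr0.
Qed.

Lemma krylov_witness (l : 'I_q) : exists M : 'M[K]_(p, q),
  M *m delta_mx l 0 = delta_mx k 0 :> 'cV_p /\
  \det (krylov (M *m M^T) (delta_mx k 0)) != 0.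
Proof.
(* An injection of rows into columns that sends [k] to [l]. *)
pose sigma i := tperm (widen_ord pq k) l (widen_ord pq i).
have inj : injective sigma.
  by move=> i j /perm_inj /(congr1 val) /= /val_inj.
exists (arrow_mx *m select_mx sigma); rewrite gram_select //; split.
  rewrite -mulmxA -[l](tpermL (widen_ord pq k)) -/(sigma k).
  by rewrite select_mx_delta // arrow_delta.
exact: arrow_krylov.
Qed.

End Arrow.

Lemma polymap_gram : polymap (fun M : 'M[K]_(p, q) => M *m M^T).
Proof. by apply: polymap_mul (polymap_tr _); apply: polymap_id. Qed.

Lemma polymap_krylov m n (N : 'M[K]_(m, n) -> 'M[K]_p) (w : 'M[K]_(m, n) -> 'cV[K]_p) :
  polymap N -> polymap w -> polymap (fun M => krylov (N M) (w M)).
Proof.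
move=> pN pw i j.
have := polymap_mul (polymap_tr pw) (polymap_exp i pN) 0 j.
by move/eq_polyfun; apply=> M; rewrite [RHS]mxE.
Qed.

Lemma generic_cyclic_gram : generic (@cyclic_gram K p' q).
Proof.
have [k0 l0] : 'I_p * 'I_q := (ord0, widen_ord pq ord0).
apply: genericW (genericI (genericI (@generic_forall K _ _ 'I_p _ _)
  (@generic_forall K _ _ 'I_q _ _)) _) => [M [[H1 H2] H3]|k|l|].
- by split; [exact: H1|exact: H2|exact: H3].
- exists (fun M => \det (krylov (M *m M^T) (delta_mx k 0))) => //; split.
    by apply/polyfun_det/polymap_krylov; [exact: polymap_gram|exact: polymap_cst].
  by have [M [_ ?]] := krylov_witness k l0; exists M.
- exists (fun M => \det (krylov (M *m M^T) (M *m delta_mx l 0))) => //; split.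
    apply/polyfun_det/polymap_krylov; first exact: polymap_gram.
    by apply: polymap_mul; [exact: polymap_id|exact: polymap_cst].
  by have [M [Ml ?]] := krylov_witness k0 l; exists M; rewrite Ml.
exists (fun M => \det (power_traces (M *m M^T))) => //; split.
  apply: polyfun_det => i j.
  have := polyfun_trace (polymap_exp (i + j) polymap_gram).
  by move/eq_polyfun; apply=> M; rewrite mxE.
by have [M ?] := power_traces_witness; exists M.
Qed.

End GenericGram.

Lemma generic_expected_critical (K : numClosedFieldType) p q :
  generic (@expected_critical K p q).
Proof.
have wide p' q' : (p' <= q')%N -> generic (@expected_critical K p' q').
  case: p' => [|p'] pq'.
    apply: genericT => M; split=> [|X [a [b [_ /eqP[]]]]]; last exact: flatmx0.
    exists [::]; split; rewrite ?min0n // => X; split=> // -[a [b [_ /eqP[]]]].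
    exact: flatmx0.
  by apply: genericW (generic_cyclic_gram K pq') => M; apply: wide_expected_critical.
have [/wide //|/ltnW/wide qp] := leqP p q.
have ptr : polymap (@trmx K p q) := polymap_tr polymap_id.
apply: genericW (generic_pullback ptr (@trmxK _ _ _) qp) => M.
exact: expected_critical_tr.
Qed.

(** * Smooth points and tangent spaces of the pattern variety *)

Section Rank1.
Variable K : numFieldType.
Variables m n : nat.

Lemma rank_le1P (X : 'M[K]_(m, n)) :
  rank_le1 K m n X <-> exists (a : 'cV_m) (b : 'cV_n), X = a *m b^T.
Proof.
split=> [|[a [b ->]]]; last exact: leq_trans (mulmx_max_rank _ _) _.
rewrite /rank_le1 /=; move: (mulmx_base X); move: (col_base X) (row_base X).
case: (\rank X) => [|[|//]] C D <- _.
  by exists 0, 0; rewrite mul0mx (flatmx0 D) mulmx0.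
by exists C, D^T; rewrite trmxK.
Qed.

Lemma rank1E (a : 'cV[K]_m) (b : 'cV[K]_n) i j : (a *m b^T) i j = a i 0 * b j 0.
Proof. by rewrite mxE big_ord_recl big_ord0 addr0 mxE. Qed.

Lemma mxdiff_linear_r (p : mxpolyring K m n) X c V W :
  mxdiff p X (c *: V + W) = c * mxdiff p X V + mxdiff p X W.
Proof.
rewrite /mxdiff mulr_sumr -big_split; apply: eq_bigr => i _.
rewrite mulr_sumr -big_split; apply: eq_bigr => j _ /=.
by rewrite !mxE mulrDr mulrCA.
Qed.

Lemma tangent_spaceD (A : set 'M[K]_(m, n)) X V W :
  tangent_space A X V -> tangent_space A X W -> tangent_space A X (V + W).
Proof.
move=> TV TW p Ap; rewrite -[V]scale1r mxdiff_linear_r TV // TW //.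
by rewrite mulr0 addr0.
Qed.

(** A polynomial vanishing on a line has zero derivative along it. *)
Lemma tangent_line (A : set 'M[K]_(m, n)) X V :
  (forall x, A (X + x *: V)) -> tangent_space A X V.
Proof.
move=> AV p Ap; have [q qE <-] := mxdiff_line p X V.
rewrite (@poly_zero_everywhere _ q) ?deriv0 ?horner0 // => x.
by rewrite qE; apply: Ap.
Qed.

(** The differentials of the equations [f * g = 0] and [f * g = h * k] *)
Lemma tangent_eq2 (A : set 'M[K]_(m, n)) X V i j k l :
  (forall Y, A Y -> Y i j * Y k l = 0) -> tangent_space A X V ->
  V i j * X k l + X i j * V k l = 0.
Proof.
move=> Aeq /(_ (mxvar K i j * mxvar K k l)); rewrite mxdiffM !mxdiffX !mxevalX.
by apply=> Y /Aeq; rewrite mxevalM !mxevalX.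
Qed.

Lemma tangent_minor (A : set 'M[K]_(m, n)) X V i j k l :
  (forall Y, A Y -> Y i j * Y k l = Y i l * Y k j) -> tangent_space A X V ->
  V i j * X k l + X i j * V k l = V i l * X k j + X i l * V k j.
Proof.
move=> Aeq TV.
have := TV (mxvar K i j * mxvar K k l + mpolyC _ (-1) * (mxvar K i l * mxvar K k j)).
rewrite mxdiffD !mxdiffM mxdiffC !mxdiffX mxevalC !mxevalX mul0r add0r mulN1r.
move=> H; apply/subr0_eq/H => Y /Aeq.
by rewrite mxevalD !mxevalM mxevalC !mxevalX => ->; rewrite mulN1r subrr.
Qed.

End Rank1.

Section PatternVariety.
Variable K : numClosedFieldType.
Variables (m n : nat) (S : {set 'I_m * 'I_n}).
Local Notation A := (rank_le1_pattern K S).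

Lemma pattern_varietyP X : A X <-> exists (a : 'cV_m) (b : 'cV_n),
  X = a *m b^T /\ forall i j, (i, j) \in S -> a i 0 * b j 0 = 0.
Proof.
split=> [[/rank_le1P[a [b XE]] XS]|[a [b [-> XS]]]].
  by exists a, b; split=> // i j /XS; rewrite XE rank1E.
by split=> [|i j /XS]; [apply/rank_le1P; exists a, b | rewrite rank1E].
Qed.

Lemma pattern_variety_minor X i j k l : A X -> X i j * X k l = X i l * X k j.
Proof. by case/pattern_varietyP => a [b [-> _]]; rewrite !rank1E; ring. Qed.

(** The equations are the 2 x 2 minors and the coordinates in [S]; a nonzero
    entry (i0, j0) exhibits the matrix as the product of its column [j0] and its
    row [i0], up to a factor. *)
Lemma pattern_variety_closed : zariski_closed A.
Proof.
exists [set p : mxpolyring K m n | forall X, A X -> mxeval p X = 0].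
apply/seteqP; split=> X /=; first by move=> AX p; apply.
move=> AX; apply/pattern_varietyP.
have minor i j k l : X i j * X k l = X i l * X k j.
  have := AX (mxvar K i j * mxvar K k l + mpolyC _ (-1) * (mxvar K i l * mxvar K k j)).
  rewrite mxevalD !mxevalM mxevalC !mxevalX mulN1r => H; apply/subr0_eq/H => Y AY.
  by rewrite mxevalD !mxevalM mxevalC !mxevalX mulN1r (pattern_variety_minor _ _ _ _ AY) subrr.
have XS i j : (i, j) \in S -> X i j = 0.
  move=> ijS; rewrite -mxevalX; apply: AX => Y [_ YS].
  by rewrite mxevalX; apply: YS.
have [X0|] := pselect (exists i j, X i j != 0); last first.
  move=> X0; exists 0, 0; split=> [|i j _]; last by rewrite !mxE mul0r.
  apply/matrixP => i j; rewrite mul0mx [RHS]mxE; apply/eqP; apply: contraT => Xij.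
  by case: X0; exists i, j.
have [i0 [j0 Xij]] := X0.
exists (\col_i X i j0), (\col_j (X i0 j / X i0 j0)).
have XE i j : X i j0 * (X i0 j / X i0 j0) = X i j.
  by rewrite mulrA (minor i j0 i0 j) mulfK.
split=> [|i j /XS <-]; last by rewrite !mxE XE.
by apply/matrixP => i j; rewrite rank1E !mxE XE.
Qed.

(** The last two conditions say that no row and no column can be added to the
    block without meeting [S]; such blocks are the supports of the generic
    points of the components. *)
Definition maximal_block p q (r : 'I_p -> 'I_m) (c : 'I_q -> 'I_n) : Prop :=
  [/\ injective r, injective c,
      forall k l, (r k, c l) \notin S,
      forall i, i \notin codom r -> exists l, (i, c l) \in S &
      forall j, j \notin codom c -> exists k, (r k, j) \in S].

Lemma block_embed_in p q (r : 'I_p -> 'I_m) (c : 'I_q -> 'I_n)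
    (a : 'cV[K]_p) (b : 'cV[K]_q) :
  maximal_block r c -> A (block_embed r c (a *m b^T)).
Proof.
case=> injr injc rcS _ _; split.
  by apply/rank_le1P; rewrite block_embed_rank1; eexists; eexists.
move=> i j ijS; apply: block_embed_out; rewrite -negb_and.
by apply/andP => -[/codomP[k ik] /codomP[l jl]]; have := rcS k l; rewrite -ik -jl ijS.
Qed.

Section BlockTangent.
Variables (p q : nat) (r : 'I_p -> 'I_m) (c : 'I_q -> 'I_n).
Hypothesis rcP : maximal_block r c.
Variables (a : 'cV[K]_p) (b : 'cV[K]_q).
Local Notation X := (block_embed r c (a *m b^T)).

Lemma tangent_row (y : 'rV[K]_q) : tangent_space A X (block_embed r c (a *m y)).
Proof.
apply: tangent_line => x; rewrite -block_embedZ -block_embedD.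
rewrite -[y]trmxK scalemxAr -mulmxDr -linearZ -linearD.
exact: block_embed_in.
Qed.

Lemma tangent_col (x : 'cV[K]_p) : tangent_space A X (block_embed r c (x *m b^T)).
Proof.
apply: tangent_line => z; rewrite -block_embedZ -block_embedD.
by rewrite scalemxAl -mulmxDl; apply: block_embed_in.
Qed.

End BlockTangent.

(** Off the zeros of the entries in a maximal block, every point of the
    variety vanishes outside this block. *)
Lemma block_support p q (r : 'I_p -> 'I_m) (c : 'I_q -> 'I_n) X :
  maximal_block r c -> A X -> (0 < p)%N -> (0 < q)%N ->
  (forall k l, X (r k) (c l) != 0) ->
  block_embed r c (block_restrict r c X) = X.
Proof.
move=> [injr injc _ rowS colS] /pattern_varietyP[a [b [XE abS]]] p0 q0 Xn0.
have ab0 k l : a (r k) 0 * b (c l) 0 != 0 by rewrite -rank1E -XE.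
apply: block_restrictK => // i j; rewrite XE rank1E => /orP[/rowS[l]|/colS[k]] /abS/eqP.
  rewrite mulf_eq0 => /orP[/eqP ->|/eqP bl]; first by rewrite mul0r.
  by case/negP: (ab0 (Ordinal p0) l); rewrite bl mulr0.
rewrite mulf_eq0 => /orP[/eqP ak|/eqP ->]; last by rewrite mulr0.
by case/negP: (ab0 k (Ordinal q0)); rewrite ak mul0r.
Qed.

Section BlockPoint.
Variables (p' q' : nat).
Local Notation p := (1 + p')%N.
Local Notation q := (1 + q')%N.
Variables (r : 'I_p -> 'I_m) (c : 'I_q -> 'I_n).
Hypothesis rcP : maximal_block r c.
Variables (a : 'cV[K]_p) (b : 'cV[K]_q).
Hypothesis ab_neq0 : forall k l, (a *m b^T) k l != 0.
Local Notation X := (block_embed r c (a *m b^T)).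

Let injr : injective r. Proof. by case: rcP. Qed.
Let injc : injective c. Proof. by case: rcP. Qed.

Let an0 k : a k 0 != 0.
Proof. by have := ab_neq0 k 0; rewrite rank1E mulf_eq0 negb_or => /andP[]. Qed.
Let bn0 l : b l 0 != 0.
Proof. by have := ab_neq0 0 l; rewrite rank1E mulf_eq0 negb_or => /andP[]. Qed.

Let XE k l : X (r k) (c l) = a k 0 * b l 0.
Proof. by rewrite -block_restrictE block_embedK // rank1E. Qed.

(** Take (i, c l) in [S] for a row [i] outside the block.  The product of the
    entries (i, j) and (r 0, c l) is a minor whose other term contains the entry
    (i, c l), so that it vanishes on the variety.  As (r 0, c l) is a nonzero
    entry of the point, the differential of this product forces
    [V i j = 0]. *)
Lemma tangent_space_out V i j : tangent_space A X V ->
  (i \notin codom r) || (j \notin codom c) -> V i j = 0.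
Proof.
move=> TV out; have Xij := block_embed_out (a *m b^T) out.
have [_ _ _ rowS colS] := rcP.
case/orP: out => [/rowS[l ilS]|/colS[k kjS]].
  have eq0 Y : A Y -> Y i j * Y (r 0) (c l) = 0.
    by move=> AY; rewrite (pattern_variety_minor _ _ _ _ AY) (AY.2 _ _ ilS) mul0r.
  have := tangent_eq2 eq0 TV; rewrite Xij mul0r addr0 => /eqP.
  by rewrite mulf_eq0 XE mulf_eq0 (negPf (an0 _)) (negPf (bn0 _)) !orbF => /eqP.
have eq0 Y : A Y -> Y i j * Y (r k) (c 0) = 0.
  by move=> AY; rewrite (pattern_variety_minor _ _ _ _ AY) (AY.2 _ _ kjS) mulr0.
have := tangent_eq2 eq0 TV; rewrite Xij mul0r addr0 => /eqP.
by rewrite mulf_eq0 XE mulf_eq0 (negPf (an0 _)) (negPf (bn0 _)) !orbF => /eqP.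
Qed.

(** Fixing the first coordinate of [a] removes the redundancy
    [(a, b) ~ (x a, b / x)] of the parametrization of rank one matrices. *)
Definition tangent_param (t : 'rV[K]_(p' + q)) : 'M[K]_(m, n) :=
  block_embed r c (col_mx 0 (lsubmx t)^T *m b^T + a *m rsubmx t).

Fact tangent_param_linear : linear tangent_param.
Proof.
move=> x s t; rewrite -block_embedZ -block_embedD; congr block_embed.
have -> : col_mx 0 (lsubmx (x *: s + t))^T =
    x *: col_mx 0 (lsubmx s)^T + col_mx 0 (lsubmx t)^T :> 'cV[K]_p.
  by rewrite !linearP /= scale_col_mx add_col_mx scaler0 addr0.
rewrite !linearP /=.
by rewrite mulmxDl -scalemxAl scalerDr addrACA.
Qed.
HB.instance Definition _ := GRing.isLinear.Build K _ _ _ tangent_param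
  tangent_param_linear.

Lemma tangent_param_inj t : tangent_param t = 0 -> t = 0.
Proof.
move=> /(congr1 (block_restrict r c)); rewrite block_embedK //.
rewrite /block_restrict mulmx0 mul0mx => /matrixP t0.
have y0 : rsubmx t = 0.
  apply/rowP => l; have := t0 (lshift p' 0) l; rewrite !mxE !big_ord_recl !big_ord0 !addr0.
  rewrite col_mxEu !mxE mul0r add0r => /eqP.
  by rewrite mulf_eq0 (negPf (an0 _)) /= => /eqP.
have x0 : lsubmx t = 0.
  apply/rowP => k; have := t0 (rshift 1 k) 0; rewrite y0 mulmx0 addr0 rank1E col_mxEd !mxE.
  by move/eqP; rewrite mulf_eq0 (negPf (bn0 _)) orbF => /eqP.
by rewrite -[t]hsubmxK x0 y0 row_mx0.
Qed.

Lemma tangent_spaceE : tangent_space A X = range tangent_param.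
Proof.
apply/seteqP; split=> [V TV|_ [t _ <-]]; last first.
  by rewrite /tangent_param block_embedD; apply: tangent_spaceD (tangent_row rcP _ _ _);
    apply: (tangent_col rcP).
pose W := block_restrict r c V.
have VE : V = block_embed r c W.
  by rewrite block_restrictK // => i j; apply: tangent_space_out.
have minor k l : W k l * (a 0 0 * b 0 0) + a k 0 * b l 0 * W 0 0
    = W k 0 * (a 0 0 * b l 0) + a k 0 * b 0 0 * W 0 l.
  rewrite !block_restrictE -!XE; apply: tangent_minor TV => Y.
  exact: pattern_variety_minor.
move: W VE minor => W VE minor.
(* Solving the differentials of the minors through the entry (0, 0) for [W];
   the subtracted term makes the first coordinate of [x] vanish. *)
pose x : 'cV[K]_p := \col_k (W k 0 / b 0 0 - a k 0 * W 0 0 / (a 0 0 * b 0 0)).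
have x0 : usubmx x = 0.
  apply/colP => i; rewrite ord1 !mxE.
  have -> : lshift p' (0 : 'I_1) = 0 by apply/val_inj.
  by field; rewrite an0 bn0.
exists (row_mx (dsubmx x)^T (\row_l (W 0 l / a 0 0))) => //.
rewrite VE /tangent_param row_mxKl row_mxKr trmxK -x0 vsubmxK; congr block_embed.
apply/matrixP => k l; rewrite mxE rank1E [X in _ + X]mxE.
rewrite big_ord_recl big_ord0 addr0 !mxE.
apply: (mulIf (_ : a 0 0 * b 0 0 != 0)); first by rewrite mulf_neq0.
rewrite /=; have -> : W k l * (a 0 0 * b 0 0) =
    W k 0 * (a 0 0 * b l 0) + a k 0 * b 0 0 * W 0 l - a k 0 * b l 0 * W 0 0.
  by rewrite -minor addrK.
by field; rewrite an0 bn0.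
Qed.

Lemma tangent_space_dim : has_dim (tangent_space A X) (p' + q).
Proof.
exists (lin1_mx (mxvec \o tangent_param)); split.
  apply: inj_row_free => t; rewrite mul_rV_lin1 /= => /(congr1 vec_mx).
  by rewrite mxvecK linear0; apply: tangent_param_inj.
rewrite tangent_spaceE; apply/seteqP; split=> [_ [t _ <-] /=|V /submxP[t]].
  by apply/submxP; exists t; rewrite mul_rV_lin1.
by rewrite mul_rV_lin1 => /(can_inj mxvecK) ->; exists t.
Qed.

(** Rank one matrices on the block with first row [rsubmx t]; the first
    coordinate of the left factor is normalized to 1. *)
Definition chart (t : 'rV[K]_(p' + q)) : 'M[K]_(m, n) :=
  block_embed r c (col_mx 1 (lsubmx t)^T *m rsubmx t).

Lemma polymap_chart : polymap chart.
Proof.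
apply: polymap_block_embed; apply: polymap_mul => u j; last first.
  by apply: eq_polyfun (polyfunX 0 (rshift p' j)) _ => t; rewrite ord1 !mxE.
rewrite -[u]fintype.splitK; case: (fintype.split u) => k /=.
  by apply: eq_polyfun (polyfun_cst (1%:M k j)) _ => t; rewrite col_mxEu.
by apply: eq_polyfun (polyfunX 0 (lshift q k)) _ => t; rewrite col_mxEd ord1 !mxE.
Qed.

Lemma chart_in t : A (chart t).
Proof. by rewrite /chart -[rsubmx t]trmxK; apply: block_embed_in. Qed.

Lemma chart_cover Y : A Y -> (forall k l, Y (r k) (c l) != 0) ->
  exists t, Y = chart t.
Proof.
move=> AY Yn0; have [u [v [YE _]]] := (pattern_varietyP Y).1 AY.
move uE: (select_mx r *m u) => u'; move vE: (select_mx c *m v) => v'.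
have u0 : u' 0 0 != 0.
  have := Yn0 0 0; rewrite YE rank1E mulf_eq0 negb_or => /andP[].
  by rewrite -uE select_mx_mul.
exists (row_mx ((u' 0 0)^-1 *: (dsubmx u')^T) (u' 0 0 *: v'^T)).
rewrite -[LHS](block_support rcP AY) // /chart row_mxKl row_mxKr.
rewrite [(_ *: _)^T]linearZ /= trmxK.
have -> : col_mx 1 ((u' 0 0)^-1 *: dsubmx u') = (u' 0 0)^-1 *: u'.
  rewrite -[RHS]vsubmxK; congr col_mx; last by apply/matrixP => i j; rewrite !mxE.
  apply/matrixP => i j; rewrite !ord1 !mxE.
  by have -> : lshift p' (0 : 'I_1) = 0 by [apply/val_inj]; rewrite mulVf.
rewrite -scalemxAl -scalemxAr scalerA mulVf // scale1r; congr block_embed.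
by rewrite /block_restrict YE -uE -vE trmx_mul !mulmxA.
Qed.

Lemma block_point_smooth : smooth_point A X.
Proof.
have AX : A X := block_embed_in _ _ rcP.
split=> //; exists (p' + q)%N; split; first exact: tangent_space_dim.
pose h (Y : 'M[K]_(m, n)) := \prod_k \prod_l Y (r k) (c l).
have ph : polyfun h.
  apply: polyfun_prod => k _; apply: polyfun_prod => l _; exact: polyfunX.
have hP Y : h Y != 0 -> forall k l, Y (r k) (c l) != 0.
  by move=> /prodf_neq0 hY k l; have /prodf_neq0/(_ l isT) := hY k isT.
have Xn0 k l : X (r k) (c l) != 0 by rewrite -block_restrictE block_embedK.
split=> [|e]; last first.
  apply: (irreducible_chain_le ph polymap_chart).
    by apply/prodf_neq0 => k _; apply/prodf_neq0 => l _.
  by move=> Y AY /hP; apply: chart_cover.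
have [t0 t0E] := chart_cover AX Xn0.
have restrict_chart t : block_restrict r c (chart t) =
    col_mx 1 (lsubmx t)^T *m rsubmx t by rewrite block_embedK.
have rowE t l : block_restrict r c (chart t) 0 l = t 0 (rshift p' l).
  rewrite restrict_chart mxE big_ord_recl big_ord0 addr0.
  have -> : 0 = lshift p' (0 : 'I_1) by apply/val_inj.
  by rewrite col_mxEu ord1 !mxE eqxx mul1r.
have colE t k : block_restrict r c (chart t) (rshift 1 k) 0
    = t 0 (lshift q k) * t 0 (rshift p' 0).
  by rewrite restrict_chart mxE big_ord_recl big_ord0 addr0 col_mxEd ord1 !mxE.
(* Row 0 of a point of the chart gives the right coordinates; the left ones are
   given by column 0 up to the entry (0, 0) of the block, nonzero at [X]. *)
pose psi (i : 'I_(p' + q)) Y := match fintype.split i with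
  | inl k => block_restrict r c Y (rshift 1 k) 0 - t0 0 i * block_restrict r c Y 0 0
  | inr l => block_restrict r c Y 0 l - t0 0 i end.
rewrite t0E; apply: (@irreducible_chain_of_chart _ _ _ _ _ chart t0 psi).
- exact: pattern_variety_closed.
- exact: polymap_chart.
- exact: chart_in.
- move=> i; rewrite /psi; case: (fintype.split i) => k.
    apply: polyfunB; first exact: polymap_block_restrict.
    by apply: polyfunM; [exact: polyfun_cst | exact: polymap_block_restrict].
  by apply: polyfunB; [exact: polymap_block_restrict | exact: polyfun_cst].
- move=> u t; rewrite /psi; case: splitP => k uk.
    have {uk}-> : u = lshift q k by apply/val_inj.
    by move=> <-; rewrite colE rowE subrr.
  have {uk}-> : u = rshift p' k by apply/val_inj.
  by move=> <-; rewrite rowE subrr.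
move=> i; rewrite /psi; case: splitP => k ik.
  have -> : i = lshift q k by apply/val_inj.
  rewrite colE rowE -mulrBl mulf_neq0 //.
    by rewrite !mxE !eqxx addrAC subrr add0r oner_neq0.
  by rewrite !mxE eq_rlshift andbF addr0 -rowE -t0E block_embedK.
have -> : i = rshift p' k by apply/val_inj.
by rewrite rowE !mxE !eqxx addrAC subrr add0r oner_neq0.
Qed.

End BlockPoint.
End PatternVariety.

(** * Counting the critical points over all components *)

Section EDCount.
Variable K : numClosedFieldType.
Variables (m n : nat) (S : {set 'I_m * 'I_n}).
Local Notation A := (rank_le1_pattern K S).

Lemma trace_rank1 p q (M : 'M[K]_(p, q)) (a : 'cV_p) (b : 'cV_q) :
  \tr (M *m (a *m b^T)^T) = dot a (M *m b).
Proof. by rewrite trmx_mul trmxK mulmxA mxtrace_mulC /dot trace_mx11. Qed.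

Lemma block_point_geometry p q (r : 'I_p -> 'I_m) (c : 'I_q -> 'I_n)
    (a : 'cV[K]_p) (b : 'cV[K]_q) :
  maximal_block S r c -> a *m b^T != 0 -> (forall k l, (a *m b^T) k l != 0) ->
  smooth_point A (block_embed r c (a *m b^T)) /\
  forall V, tangent_space A (block_embed r c (a *m b^T)) V ->
    exists x y, V = block_embed r c (x *m b^T + a *m y).
Proof.
case: p q r c a b => [|p'] [|q'] r c a b rcP;
  try by rewrite ?[_ *m _]flatmx0 ?[_ *m _]thinmx0 eqxx.
move=> _ ab0; split; first exact: (block_point_smooth (p' := p') (q' := q') rcP).
move=> V; rewrite (tangent_spaceE (p' := p') (q' := q') rcP) // => -[t _ <-].
by eexists; eexists; reflexivity.
Qed.

Section OneBlock.
Variables (p q : nat) (r : 'I_p -> 'I_m) (c : 'I_q -> 'I_n).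
Hypothesis rcP : maximal_block S r c.
Variable U : 'M[K]_(m, n).
Local Notation M := (block_restrict r c U).

Let restrictB (X' : 'M[K]_(p, q)) :
  block_restrict r c (U - block_embed r c X') = M - X'.
Proof.
case: rcP => injr injc _ _ _.
by rewrite -[X' in RHS](block_embedK injr injc) /block_restrict mulmxBr mulmxBl.
Qed.

Lemma critical_point_block X' :
  critical_points A U (block_embed r c X') -> X' != 0 ->
  rank_le1 K p q X' -> critical_rank1 M X'.
Proof.
move=> [_ orth] X'0 /rank_le1P[a [b X'E]].
have orth1 x y : tangent_space A (block_embed r c X') (block_embed r c (x *m y^T)) ->
    dot x ((M - X') *m y) = 0.
  by move=> /orth; rewrite trace_block_embed restrictB trace_rank1.
have col0 : (M - X')^T *m a = 0.
  apply/colP => l; rewrite [RHS]mxE -dot_delta dotC dotMl trmxK.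
  rewrite -[delta_mx l 0]trmxK; apply: orth1.
  by rewrite X'E; apply: tangent_row.
have row0 : (M - X') *m b = 0.
  apply/colP => k; rewrite [RHS]mxE -dot_delta; apply: orth1.
  by rewrite X'E; apply: tangent_col.
exists a, b; split=> //.
  move/eqP: col0; rewrite linearB /= mulmxBl subr_eq0 => /eqP ->.
  by rewrite X'E trmx_mul trmxK -mulmxA mul_tr_dot mul_mx_scalar.
move/eqP: row0; rewrite mulmxBl subr_eq0 => /eqP ->.
by rewrite X'E -mulmxA mul_tr_dot mul_mx_scalar.
Qed.

Lemma block_critical_point (X' : 'M[K]_(p, q)) : (forall k l, X' k l != 0) ->
  critical_rank1 M X' -> critical_points A U (block_embed r c X').
Proof.
move=> X'n0 [a [b [X'E X'0 Ma Mb]]].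
have row0 : (M - X') *m b = 0.
  by rewrite mulmxBl Mb X'E -mulmxA mul_tr_dot mul_mx_scalar subrr.
have col0 : a^T *m (M - X') = 0.
  rewrite mulmxBr -[a^T *m M]trmxK trmx_mul trmxK Ma linearZ /= X'E mulmxA.
  by rewrite mul_tr_dot mul_scalar_mx subrr.
have orth V : (exists x y, V = block_embed r c (x *m b^T + a *m y)) ->
    \tr ((U - block_embed r c X') *m V^T) = 0.
  move=> [x [y ->]]; rewrite trace_block_embed restrictB linearD mulmxDr linearD /=.
  rewrite trace_rank1 row0 -[y]trmxK trace_rank1 /dot mulmx0 mulmxA col0 mul0mx.
  by rewrite !mxE addr0.
have := block_point_geometry rcP (a := a) (b := b); rewrite -X'E.
by case=> // smoothX tanX; split=> // V /tanX; apply: orth.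
Qed.

End OneBlock.

Section Components.
Hypothesis inj1 : {in S &, injective fst}.
Hypothesis inj2 : {in S &, injective snd}.
Implicit Type J : {set 'I_m * 'I_n}.

(** In the component of [J] the positions of [J] vanish because of their rows,
    the other positions of [S] because of their columns. *)
Definition comp_rows J : {set 'I_m} := ~: (fst @: J).
Definition comp_cols J : {set 'I_n} := ~: (snd @: (S :\: J)).
Definition comp_row J (k : 'I_#|comp_rows J|) : 'I_m := enum_val k.
Definition comp_col J (l : 'I_#|comp_cols J|) : 'I_n := enum_val l.

Lemma codom_enum_val (T : finType) (B : {set T}) x :
  (x \in codom (enum_val : 'I_#|B| -> T)) = (x \in B).
Proof.
apply/codomP/idP => [[k ->]|xB]; first exact: enum_valP.
by exists (enum_rank_in xB x); rewrite enum_rankK_in.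
Qed.

(** A row removed for the sake of (i, j) in [J] still meets column [j]: this
    column could only be removed for another position of [S] in column [j].
    Likewise for columns. *)
Lemma comp_maximal_block J : J \subset S ->
  maximal_block S (@comp_row J) (@comp_col J).
Proof.
move=> /fintype.subsetP JS; split; try exact: enum_val_inj.
- move=> k l; apply/negP => klS; have := enum_valP k; have := enum_valP l.
  rewrite !inE; case: (boolP ((comp_row k, comp_col l) \in J)) => klJ.
    by move=> _ /negP[]; apply/imsetP; exists (comp_row k, comp_col l).
  by move=> /negP[]; apply/imsetP; exists (comp_row k, comp_col l); rewrite // inE klJ.
- move=> i; rewrite codom_enum_val inE negbK => /imsetP[[i' j] ijJ /= ->].
  have : j \in comp_cols J.
    rewrite inE; apply/imsetP => -[e]; rewrite inE => /andP[eJ eS] je.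
    by move: eJ; rewrite -(inj2 (JS _ ijJ) eS je) ijJ.
  by rewrite -codom_enum_val => /codomP[l jl]; exists l; rewrite -[comp_col l]jl JS.
move=> j; rewrite codom_enum_val inE negbK => /imsetP[[i j']].
rewrite inE => /andP[ijJ ijS] /= ->.
have : i \in comp_rows J.
  rewrite inE; apply/imsetP => -[e eJ ie].
  by move: ijJ; rewrite (inj1 ijS (JS _ eJ) ie) eJ.
by rewrite -codom_enum_val => /codomP[k ik]; exists k; rewrite -[comp_row k]ik.
Qed.

Lemma in_some_component X : A X -> exists2 J : {set 'I_m * 'I_n}, J \subset S &
  block_embed (@comp_row J) (@comp_col J)
    (block_restrict (@comp_row J) (@comp_col J) X) = X.
Proof.
move=> /pattern_varietyP[a [b [XE abS]]].
exists [set e in S | a e.1 0 == 0]%SET.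
  by apply/fintype.subsetP => e; rewrite inE => /andP[].
apply: block_restrictK => [||i j]; try exact: enum_val_inj.
rewrite XE rank1E !codom_enum_val !inE !negbK => /orP[]/imsetP[e].
  by rewrite inE => /andP[_ /eqP ae] ->; rewrite ae mul0r.
rewrite !inE => /andP[/nandP[/negP//|ae] eS] ->.
have := abS e.1 e.2; rewrite -surjective_pairing => /(_ eS)/eqP.
by rewrite mulf_eq0 (negPf ae) /= => /eqP ->; rewrite mulr0.
Qed.

(** The component of a point without zeros in its block can be read off from
    its support. *)
Lemma comp_rows_support J (Y : 'M[K]_(#|comp_rows J|, #|comp_cols J|)) i :
  Y != 0 -> (forall k l, Y k l != 0) ->
  (i \in comp_rows J) =
  [exists j, block_embed (@comp_row J) (@comp_col J) Y i j != 0].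
Proof.
move=> Y0 Yn0; apply/idP/existsP => [|[j]]; last first.
  apply: contraR => iJ; rewrite block_embed_out //.
  by rewrite codom_enum_val iJ.
rewrite -codom_enum_val => /codomP[k ->].
have [l _] : exists l : 'I_#|comp_cols J|, true.
  apply: contrapT => nol; case/eqP: Y0; apply/matrixP => k' l.
  by case: nol; exists l.
exists (comp_col l).
rewrite -[enum_val k]/(comp_row k) -block_restrictE block_embedK //; exact: enum_val_inj.
Qed.

Lemma comp_rows_inj J : J \subset S -> J = [set e in S | e.1 \notin comp_rows J]%SET.
Proof.
move=> /fintype.subsetP JS; apply/setP => e; rewrite !inE negbK.
apply/idP/andP => [eJ|[eS /imsetP[e' eJ' ee']]].
  by split; [exact: JS | exact: imset_f].
by rewrite (inj1 eS (JS _ eJ') ee').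
Qed.

Lemma component_unique J1 J2 (Y1 : 'M[K]_(#|comp_rows J1|, #|comp_cols J1|))
    (Y2 : 'M[K]_(#|comp_rows J2|, #|comp_cols J2|)) : J1 \subset S -> J2 \subset S ->
  Y1 != 0 -> Y2 != 0 -> (forall k l, Y1 k l != 0) -> (forall k l, Y2 k l != 0) ->
  block_embed (@comp_row J1) (@comp_col J1) Y1 =
  block_embed (@comp_row J2) (@comp_col J2) Y2  -> J1 = J2.
Proof.
move=> J1S J2S Y10 Y20 Y1n0 Y2n0 eqX.
suff rows : comp_rows J1 = comp_rows J2.
  by rewrite (comp_rows_inj J1S) (comp_rows_inj J2S) rows.
apply/setP => i.
by rewrite (comp_rows_support _ Y10 Y1n0) eqX -(comp_rows_support _ Y20 Y2n0).
Qed.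

Lemma card_comp_rows J : J \subset S -> #|comp_rows J| = (m - #|J|)%N.
Proof.
move=> /fintype.subsetP JS; rewrite cardsCs finset.setCK card_ord card_in_imset //.
by move=> e e' /JS eS /JS; apply: inj1.
Qed.

Lemma card_comp_cols J : J \subset S -> #|comp_cols J| = (n - #|S| + #|J|)%N.
Proof.
move=> JS; rewrite cardsCs finset.setCK card_ord card_in_imset; last first.
  by move=> e e'; rewrite !inE => /andP[_ eS] /andP[_]; apply: inj2.
have Sn : (#|S| <= n)%N.
  by rewrite -(card_in_imset inj2) -[X in (_ <= X)%N]card_ord max_card.
rewrite cardsD (finset.setIidPr JS); have := subset_leq_card JS.
by move=> JleS; rewrite subnBA // addnC -addnBA // addnC.
Qed.

(** The second condition excludes the critical point 0. *)
Definition general_data (U : 'M[K]_(m, n)) : Prop :=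
  (forall J, expected_critical (block_restrict (@comp_row J) (@comp_col J) U)) /\
  (exists i j, (i, j) \notin S /\ U i j != 0).

Lemma general_data_generic : S \proper [set: 'I_m * 'I_n]%SET -> generic general_data.
Proof.
case/properP => _ [[i j] _ ijS].
apply: genericI.
  apply: generic_forall => J.
  apply: (@generic_pullback _ _ _ _ _ _ (block_embed (@comp_row J) (@comp_col J))).
  - exact: polymap_block_restrict.
  - by apply: block_embedK; exact: enum_val_inj.
  - exact: generic_expected_critical.
exists (fun U => U i j); last by move=> U Uij; exists i, j.
split; first exact: polyfunX.
by exists (const_mx 1); rewrite mxE oner_neq0.
Qed.

(** The coordinate direction (i, j) outside [S] is a line in the variety
    through 0. *)
Lemma critical_point_neq0 U X : general_data U -> critical_points A U X -> X != 0.
Proof.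
move=> [_ [i [j [ijS Uij]]]] [_ orth]; apply: contra Uij => /eqP X0; rewrite X0 in orth.
have /orth : tangent_space A 0 (delta_mx i j).
  apply: tangent_line => x; rewrite add0r; apply/pattern_varietyP.
  exists (x *: delta_mx i 0), (delta_mx j 0); split.
    by rewrite trmx_delta -scalemxAl mul_delta_mx.
  move=> k l klS; rewrite !mxE !eqxx !andbT.
  case: eqP => [ki|_]; last by rewrite mulr0 mul0r.
  case: eqP => [lj|_]; last by rewrite mulr0.
  by move: klS; rewrite ki lj (negPf ijS).
have -> : delta_mx i j = delta_mx i 0 *m (delta_mx j 0 : 'cV[K]_n)^T.
  by rewrite trmx_delta mul_delta_mx.
by rewrite subr0 trace_rank1 dot_delta -colE mxE => ->.
Qed.

(** The list concatenates, over all [J], the critical points of the components;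
    these lists are disjoint since the support of a point determines [J]. *)
Lemma component_critical_points U : general_data U ->
  exists s : seq 'M[K]_(m, n), [/\ uniq s,
    size s = (\sum_(J in powerset S) minn (m - #|J|) (n - #|S| + #|J|))%N &
    forall X, critical_points A U X <-> X \in s].
Proof.
move=> gU; have [niceU _] := gU.
have crits J : exists s : seq 'M[K]_(#|comp_rows J|, #|comp_cols J|),
    [/\ uniq s, size s = minn #|comp_rows J| #|comp_cols J| &
    forall X, critical_rank1 (block_restrict (@comp_row J) (@comp_col J) U) X <-> X \in s].
  by case: (niceU J).
have [t tP] : exists t : forall J, seq 'M[K]_(#|comp_rows J|, #|comp_cols J|), forall J,
    [/\ uniq (t J), size (t J) = minn #|comp_rows J| #|comp_cols J| &
    forall X, critical_rank1 (block_restrict (@comp_row J) (@comp_col J) U) X <-> X \in t J].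
  by exists (fun J => sval (cid (crits J))) => J; case: (cid (crits J)).
have tn0 J X : X \in t J -> X != 0 /\ forall k l, X k l != 0.
  have [_ _ tJ] := tP J; move=> /tJ Xcrit.
  by split; [case: Xcrit => a [b []] | apply: (niceU J).2].
pose emb J X := block_embed (@comp_row J) (@comp_col J) X : 'M[K]_(m, n).
have embK J : cancel (emb J) (block_restrict (@comp_row J) (@comp_col J)).
  by apply: block_embedK; exact: enum_val_inj.
exists [seq emb J X | J <- enum (powerset S), X <- t J]; split.
- apply: allpairs_uniq_dep => [|J _|]; first exact: enum_uniq.
    by have [] := tP J.
  move=> _ _ /allpairsPdep[J1 [X1 [J1S X1t ->]]] /allpairsPdep[J2 [X2 [J2S X2t ->]]] /= eqX.
  have [X10 X1n0] := tn0 _ _ X1t; have [X20 X2n0] := tn0 _ _ X2t.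
  rewrite !mem_enum !inE in J1S J2S.
  have eqJ := component_unique J1S J2S X10 X20 X1n0 X2n0 eqX.
  move: X2 {X2t X20 X2n0} eqX; rewrite -eqJ => X2 eqX.
  by rewrite (can_inj (embK J1) eqX).
- rewrite size_allpairs_dep sumnE big_map big_enum; apply: eq_bigr => J.
  rewrite inE => JS; have [_ -> _] := tP J.
  by rewrite card_comp_rows // card_comp_cols.
move=> X; split=> [Xcrit|/allpairsPdep[J [Y [JS Yt ->]]]]; last first.
  rewrite mem_enum inE in JS; have [Y0 Yn0] := tn0 _ _ Yt.
  have [_ _ tJ] := tP J; apply: block_critical_point => //; last exact/tJ.
  exact: comp_maximal_block.
have X0 := critical_point_neq0 gU Xcrit.
have [J JS XE] := in_some_component Xcrit.1.1.
set Y := block_restrict _ _ X in XE.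
apply/allpairsPdep; exists J, Y; split=> //; first by rewrite mem_enum inE.
have [_ _ tJ] := tP J; apply/tJ; apply: (critical_point_block (comp_maximal_block JS)).
- by rewrite XE.
- by apply: contraNneq X0 => Y0; rewrite -XE Y0 /block_embed mulmx0 mul0mx.
have [a [b [XabE _]]] := (pattern_varietyP _ _).1 Xcrit.1.1.
apply/rank_le1P; exists (select_mx (@comp_row J) *m a), (select_mx (@comp_col J) *m b).
by rewrite /Y /block_restrict XabE trmx_mul !mulmxA.
Qed.

End Components.
End EDCount.

Lemma sum_powerset_card (T : finType) (B : {set T}) (F : nat -> nat) :
  (\sum_(J in powerset B) F #|J| = \sum_(0 <= j < #|B|.+1) 'C(#|B|, j) * F j)%N.
Proof.
rewrite big_mkord.
rewrite (partition_big (fun J : {set T} => inord #|J| : 'I_#|B|.+1) xpredT) //=.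
apply: eq_bigr => j _; rewrite -cards_draws -sum_nat_const.
apply: eq_big => [J|J].
  rewrite !inE; case: (boolP (J \subset B)) => //= /subset_leq_card JB.
  by rewrite -(inj_eq val_inj) /= inordK.
rewrite inE => /andP[/subset_leq_card JB /eqP <-].
by rewrite inordK.
Qed.

Lemma perm_equivalent_diag_matching m n (S : {set 'I_m * 'I_n}) s :
  perm_equivalent S (diag_pattern m n s) ->
  {in S &, injective fst} /\ {in S &, injective snd}.
Proof.
move=> [P1 [P2 [/is_perm_mxP[u ->] /is_perm_mxP[v ->] maskE]]].
have SE e : e \in S -> u e.1 = (v^-1)%g e.2 :> nat.
  move=> eS; have := congr1 (fun M : 'M[int]_(m, n) => M e.1 e.2) maskE.
  rewrite -row_permE -[v in perm_mx v]invgK -col_permE !mxE -surjective_pairing eS inE /=.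
  by case: eqP.
split=> [[i j] [i' j'] /SE /= e /SE /= e' /= eqi|[i j] [i' j'] /SE /= e /SE /= e' /= eqj].
  rewrite eqi in e *; congr pair; apply: (@perm_inj _ (v^-1)%g); apply: val_inj.
  by rewrite /= -e.
rewrite eqj in e *; congr pair; apply: (@perm_inj _ u); apply: val_inj.
by rewrite /= e.
Qed.

Lemma card_eq_mem_seq (T : choiceType) (A : set T) (s : seq T) :
  uniq s -> (forall x, A x <-> x \in s) -> (A #= `I_(size s))%card.
Proof.
move=> us sP; apply/card_set_bijP; exists (index^~ s); split.
- by move=> x /sP; rewrite /= index_mem.
- move=> x y /set_mem/sP xs /set_mem/sP ys eqi.
  by rewrite -(nth_index x xs) eqi nth_index.
case: s us sP => [|x0 s] // us sP k ks.
by exists (nth x0 (x0 :: s) k); [apply/sP; rewrite mem_nth | rewrite index_uniq].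
Qed.

Theorem corollary3p9 (R : realType) (m n : nat) (S : {set 'I_m * 'I_n})
  (properS : S \proper [set: 'I_m * 'I_n]%SET)
  (diagS : perm_equivalent S (diag_pattern m n #|S|)) :
  is_EDdegree (rank_le1_pattern R[i] S)
    (\sum_(0 <= j < #|S|.+1) 'C(#|S|, j) * minn (m - j) (n - #|S| + j))%N.
Proof.
have [inj1 inj2] := perm_equivalent_diag_matching diagS.
have [f [pf [U0 fU0]] fP] := @general_data_generic R[i] m n S properS.
exists [set U | f U = 0]; split.
- exact: closed_zero_locus.
- by move=> /seteqP[_ /(_ U0 I)] /eqP; apply/negP.
move=> U /eqP/fP /(component_critical_points inj1 inj2)[s [us ss sP]].
rewrite -(sum_powerset_card S (fun j => minn (m - j) (n - #|S| + j))%N) -ss.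
exact: card_eq_mem_seq.
Qed.
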